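(* GL-Partition is polynomial-time solvable on $k$-connected interval graphs: there is a polynomial-time algorithm that, given an instance $(G,k,C,N)$ of the GL-Partition problem in which $G$ is a $k$-connected interval graph, computes a GL-partition of the instance.
   Context: All graphs are finite, undirected and simple. A graph is $k$-connected if it has more than $k$ vertices and the removal of any vertex set of size at most $k-1$ does not disconnect it. A graph is an interval graph if its vertices can be represented by intervals on the real line so that two distinct vertices are adjacent if and only if their intervals intersect. GL-Partition problem: an instance $(G,k,C,N)$ consists of a graph $G=(V,E)$, an integer $k\ge 1$, a set of $k$ distinct vertices $C=\{c_1,\ldots,c_k\}\subseteq V$ (terminals), and $k$ positive integers $N=\{n_1,\ldots,n_k\}$ (a list indexed by $[k]$, repetitions allowed) with $\sum_{i=1}^k n_i=|V|$. The task is to compute a GL-partition: a partition of $V$ into disjoint sets $V_1,\ldots,V_k$ with $|V_i|=n_i$, $c_i\in V_i$ and $G[V_i]$ connected for all $i\in[k]$. *)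

(* Defs.v *)
From mathcomp Require Import all_boot all_order all_algebra.
From mathcomp Require Import reals.

Set Implicit Arguments.
Unset Strict Implicit.
Unset Printing Implicit Defensive.

(** * Polynomial time

   The machine model is a random access machine with structured control: nat
   registers and zero-initialised nat arrays of unbounded length, of which a
   program mentions only finitely many.  Every operation costs one step.  The
   only arithmetic is addition and truncated subtraction, so a run of [t] steps
   lengthens the binary representations of values by only O(t) bits; hence
   polynomial time for this model is polynomial time for Turing machines.
   Comparisons are expressed by subtraction: [a < b] iff [b - a] is nonzero. *)

Inductive expr : Type :=
| Const of nat
| Reg of nat
| Get of nat & expr
| Add of expr & expr
| Sub of expr & expr.

Inductive cmd : Type :=
| Skip
| SetReg of nat & expr
| SetArr of nat & expr & expr
| Seq of cmd & cmd
| If of expr & cmd & cmd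
| While of expr & cmd.

Record state : Type := State { reg : nat -> nat; arr : nat -> nat -> nat }.

Definition set_reg (s : state) (r x : nat) : state :=
  State (fun r' => if r' == r then x else reg s r') (arr s).

Definition set_arr (s : state) (a i x : nat) : state :=
  State (reg s)
    (fun a' i' => if (a' == a) && (i' == i) then x else arr s a' i').

Fixpoint eval (s : state) (e : expr) : nat :=
  match e with
  | Const c => c
  | Reg r => reg s r
  | Get a e1 => arr s a (eval s e1)
  | Add e1 e2 => eval s e1 + eval s e2
  | Sub e1 e2 => eval s e1 - eval s e2
  end.

Fixpoint cost (e : expr) : nat :=
  match e with
  | Const _ | Reg _ => 1
  | Get _ e1 => (cost e1).+1
  | Add e1 e2 | Sub e1 e2 => (cost e1 + cost e2).+1
  end.

(* [exec P s t s']: started in [s], the program [P] halts in [s'] after exactly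
   [t] steps. *)
Inductive exec : cmd -> state -> nat -> state -> Prop :=
| exec_skip s : exec Skip s 1 s
| exec_set_reg s r e :
    exec (SetReg r e) s (cost e).+1 (set_reg s r (eval s e))
| exec_set_arr s a e1 e2 :
    exec (SetArr a e1 e2) s (cost e1 + cost e2).+1
         (set_arr s a (eval s e1) (eval s e2))
| exec_seq P Q s1 s2 s3 t1 t2 :
    exec P s1 t1 s2 -> exec Q s2 t2 s3 -> exec (Seq P Q) s1 (t1 + t2) s3
| exec_if_true e P Q s t s' :
    eval s e != 0 -> exec P s t s' -> exec (If e P Q) s (cost e + t).+1 s'
| exec_if_false e P Q s t s' :
    eval s e = 0 -> exec Q s t s' -> exec (If e P Q) s (cost e + t).+1 s'
| exec_while_true e P s1 s2 s3 t1 t2 :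
    eval s1 e != 0 -> exec P s1 t1 s2 -> exec (While e P) s2 t2 s3 ->
    exec (While e P) s1 (cost e + t1 + t2).+1 s3
| exec_while_false e P s :
    eval s e = 0 -> exec (While e P) s (cost e).+1 s.

(* A word is passed in array 0, with its length in register 0. *)
Definition input_state (w : seq nat) : state :=
  State (fun r => if r == 0 then size w else 0)
        (fun a i => if a == 0 then nth 0 w i else 0).

Definition output (s : state) : seq nat := mkseq (arr s 0) (reg s 0).

(* The number of bits of a word: [(trunc_log 2 x).+1] is the number of binary
   digits of [x] (one digit for 0). *)
Definition bit_size (w : seq nat) : nat := \sum_(x <- w) (trunc_log 2 x).+1.

(* The search problem with instances [x : I], written on the input as [enc x],
   and with set of correct answers [sol x], is solvable in polynomial time on
   the instances satisfying [promise]. *)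
Definition poly_time_solvable (I : Type) (enc : I -> seq nat)
    (promise : I -> Prop) (sol : I -> seq nat -> Prop) : Prop :=
  exists (P : cmd) (c d : nat), forall x : I, promise x ->
    exists (t : nat) (s : state),
      [/\ exec P (input_state (enc x)) t s,
          t <= c * bit_size (enc x) ^ d + c
        & sol x (output s)].

(** * Graphs *)

Record sgraph (T : finType) : Type := SGraph {
  adj :> rel T;
  adj_sym : symmetric adj;
  adj_irr : irreflexive adj }.

Definition induced_connected (T : finType) (G : sgraph T) (A : {set T}) : Prop :=
  forall u v, u \in A -> v \in A ->
    connect [rel x y | [&& x \in A, y \in A & G x y]] u v.

Definition k_connected (T : finType) (G : sgraph T) (k : nat) : Prop :=
  k < #|T| /\
  forall S : {set T}, #|S| <= k - 1 -> induced_connected G (~: S).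

(* Intervals may be open, closed, half-open or unbounded, but not empty. *)
Definition interval_graph (R : realType) (T : finType) (G : sgraph T) : Prop :=
  exists J : T -> interval R,
    (forall v, exists x : R, x \in J v) /\
    (forall u v, u != v ->
       (G u v <-> exists x : R, x \in J u /\ x \in J v)).

(** * The GL-Partition problem *)

Record gl_instance : Type := GLInstance {
  gl_n : nat;
  gl_graph : sgraph 'I_gl_n;
  gl_k : nat;
  gl_k_gt0 : 0 < gl_k;
  gl_terminal : 'I_gl_k -> 'I_gl_n;
  gl_terminal_inj : injective gl_terminal;
  gl_size : 'I_gl_k -> nat;
  gl_size_gt0 : forall i, 0 < gl_size i;
  gl_size_sum : \sum_(i < gl_k) gl_size i = gl_n }.

Definition is_gl_partition (x : gl_instance)
    (V : 'I_(gl_k x) -> {set 'I_(gl_n x)}) : Prop :=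
  [/\ forall i j, i != j -> [disjoint V i & V j],
      \bigcup_(i < gl_k x) V i = [set: 'I_(gl_n x)]
    & forall i, [/\ #|V i| = gl_size i,
                    gl_terminal i \in V i
                  & induced_connected (gl_graph x) (V i)]].

(* Number of vertices, number of terminals, adjacency matrix by rows, terminals,
   sizes.  Vertices and parts are numbered from 0. *)
Definition encode_instance (x : gl_instance) : seq nat :=
  [:: gl_n x; gl_k x]
  ++ [seq nat_of_bool (gl_graph x u v) | u <- enum 'I_(gl_n x),
                                         v <- enum 'I_(gl_n x)]
  ++ [seq val (gl_terminal i) | i <- enum 'I_(gl_k x)]
  ++ [seq gl_size i | i <- enum 'I_(gl_k x)].

(* The [k x n] incidence matrix by rows: row [i] is the indicator of [V i]. *)
Definition encode_partition (n k : nat) (V : 'I_k -> {set 'I_n}) : seq nat :=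
  [seq nat_of_bool (v \in V i) | i <- enum 'I_k, v <- enum 'I_n].

(* Main.v *)
(** Only the existence of a simplicial vertex in every nonempty vertex set is
   used, so the algorithm works on all chordal graphs.  Removing simplicial
   vertices one by one orders the vertices; by [k]-connectivity the later
   neighbours of a vertex form a clique that has at least [k] members or
   contains all later vertices ([elim_order]).  Think of every unfinished part
   as contracted to a single vertex, a terminal, and of every finished part as
   deleted; [k] is the number of terminals left.  Deleting a vertex lowers both
   [k] and the clique sizes by at most one.  An edge is mixed if exactly one of
   its ends is a terminal; contracting it adds one vertex to a part.  Counting
   later neighbours shows that a mixed edge exists while some vertex is
   unassigned, and that no terminal comes before the first vertex [x] that is
   the earlier end of a mixed edge.  Hence contracting such an edge [x y] into
   [y] does not shrink any clique of later neighbours, and the elimination order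
   survives. *)

Require Import Defs.
From mathcomp Require Import all_boot all_order all_algebra.
From mathcomp Require Import reals.
From mathcomp Require Import zify.
From Stdlib Require Import FunctionalExtensionality.
(* [eqtype] also defines [Sub]. *)
Import Defs.

Set Implicit Arguments.
Unset Strict Implicit.
Unset Printing Implicit Defensive.

(** * Programs with bounded loops *)

(** A fragment in which every loop makes as many passes as register 1 says: it has a total semantics
    and a time bound that can be read off the syntax. *)
Inductive prog : Type :=
| PSkip
| PReg of nat & expr
| PArr of nat & expr & expr
| PSeq of prog & prog
| PIf of expr & prog & prog
| PFor of nat & prog.

Fixpoint compile (p : prog) : cmd :=
  match p with
  | PSkip => Skip
  | PReg r e => SetReg r e
  | PArr a e1 e2 => SetArr a e1 e2
  | PSeq p q => Seq (compile p) (compile q)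
  | PIf e p q => If e (compile p) (compile q)
  | PFor r p =>
      Seq (SetReg r (Const 0))
          (While (Sub (Reg 1) (Reg r))
                 (Seq (compile p) (SetReg r (Add (Reg r) (Const 1)))))
  end.

Fixpoint run (n : nat) (p : prog) (s : state) : state :=
  match p with
  | PSkip => s
  | PReg r e => set_reg s r (eval s e)
  | PArr a e1 e2 => set_arr s a (eval s e1) (eval s e2)
  | PSeq p q => run n q (run n p s)
  | PIf e p q => if eval s e != 0 then run n p s else run n q s
  | PFor r p =>
      iter n (fun s => set_reg (run n p s) r (reg (run n p s) r + 1))
           (set_reg s r 0)
  end.

Fixpoint regs_of (p : prog) : seq nat :=
  match p with
  | PReg r _ => [:: r]
  | PSeq p q | PIf _ p q => regs_of p ++ regs_of q
  | PFor r p => r :: regs_of p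
  | _ => [::]
  end.

Fixpoint arrs_of (p : prog) : seq nat :=
  match p with
  | PArr a _ _ => [:: a]
  | PSeq p q | PIf _ p q => arrs_of p ++ arrs_of q
  | PFor _ p => arrs_of p
  | _ => [::]
  end.

Fixpoint wf (p : prog) : bool :=
  match p with
  | PReg r _ => r != 1
  | PSeq p q | PIf _ p q => wf p && wf q
  | PFor r p => [&& r != 1, r \notin regs_of p & wf p]
  | _ => true
  end.

(** In a loop, 6 pays for the reset of the counter and the failing last test, and 8 for a successful
    test and the increment. *)
Fixpoint time (n : nat) (p : prog) : nat :=
  match p with
  | PSkip => 1
  | PReg _ e => (cost e).+1
  | PArr _ e1 e2 => (cost e1 + cost e2).+1
  | PSeq p q => time n p + time n q
  | PIf e p q => (cost e + (time n p + time n q)).+1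
  | PFor _ p => 6 + n * (time n p + 8)
  end.

Lemma run_reg n p s r : r \notin regs_of p -> reg (run n p s) r = reg s r.
Proof.
elim: p s => [|r1 e|a e1 e2|p IHp q IHq|e p IHp q IHq|r1 p IHp] s //=.
- by rewrite inE => /negbTE ->.
- by rewrite mem_cat negb_or => /andP[hp hq]; rewrite IHq // IHp.
- by rewrite mem_cat negb_or => /andP[hp hq]; case: ifP => _; [exact: IHp | exact: IHq].
rewrite inE negb_or => /andP[/negbTE hr hp].
set f := (fun s => _).
suff: forall m s', reg (iter m f s') r = reg s' r by move=> -> /=; rewrite hr.
by elim=> [|m IHm] s' //=; rewrite hr IHp // IHm.
Qed.

Lemma run_arr n p s a : a \notin arrs_of p -> arr (run n p s) a = arr s a.
Proof.
elim: p s => [|r1 e|b e1 e2|p IHp q IHq|e p IHp q IHq|r1 p IHp] s //=.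
- by rewrite inE => /negbTE ->.
- by rewrite mem_cat negb_or => /andP[hp hq]; rewrite IHq // IHp.
- by rewrite mem_cat negb_or => /andP[hp hq]; case: ifP => _; [exact: IHp | exact: IHq].
move=> hp; set f := (fun s => _).
suff: forall m s', arr (iter m f s') a = arr s' a by move=> ->.
by elim=> [|m IHm] s' //=; rewrite IHp // IHm.
Qed.

Lemma wf_reg1 p : wf p -> 1 \notin regs_of p.
Proof.
elim: p => [|r e|a e1 e2|p IHp q IHq|e p IHp q IHq|r p IHp] //=.
- by rewrite inE eq_sym.
- by case/andP=> hp hq; rewrite mem_cat negb_or IHp ?IHq.
- by case/andP=> hp hq; rewrite mem_cat negb_or IHp ?IHq.
by case/and3P=> hr _ hp; rewrite inE negb_or eq_sym hr IHp.
Qed.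

(* The side conditions in [wf] make the trip count of a compiled loop the value
   that register 1 has on entry. *)
Lemma exec_compile n p s :
    wf p -> reg s 1 = n ->
  exists2 t, exec (compile p) s t (run n p s) & t <= time n p.
Proof.
elim: p s => [|r e|a e1 e2|p IHp q IHq|e p IHp q IHq|r p IHp] s /=.
- by exists 1 => //; constructor.
- by exists (cost e).+1 => //; constructor.
- by exists (cost e1 + cost e2).+1 => //; constructor.
- case/andP=> hp hq hs; have [t1 e1 l1] := IHp s hp hs.
  have [|t2 e2 l2] := IHq (run n p s) hq; first by rewrite run_reg // wf_reg1.
  by exists (t1 + t2); [exact: exec_seq e1 e2 | exact: leq_add].
- case/andP=> hp hq hs; case: ifP => he.
    have [t1 e1 l1] := IHp s hp hs.
    by exists (cost e + t1).+1; [exact: exec_if_true | lia].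
  have [t1 e1 l1] := IHq s hq hs.
  by exists (cost e + t1).+1; [apply: exec_if_false => //; apply/eqP/negbFE | lia].
case/and3P=> r1 rp hp hs; pose f s := set_reg (run n p s) r (reg (run n p s) r + 1).
set w := While _ _.
(* [m] counts the passes that remain. *)
have loop m s' : reg s' 1 = n -> reg s' r + m = n ->
    exists2 t, exec w s' t (iter m f s') & t <= 4 + m * (time n p + 8).
  elim: m s' => [|m IHm] s' h1 hr.
    by exists 4 => //; apply: exec_while_false => /=; lia.
  rewrite iterSr; have [t1 e1 l1] := IHp s' hp h1.
  have hrp : reg (run n p s') r = reg s' r by rewrite run_reg.
  have [||t2 e2 l2] := IHm (f s').
  - by rewrite /= eq_sym (negbTE r1) run_reg // wf_reg1.
  - by rewrite /= eqxx hrp; lia.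
  have := exec_while_true _ (exec_seq e1 (exec_set_reg _ r (Add (Reg r) (Const 1)))) e2.
  move=> /= h; eexists; first by apply: h; lia.
  by rewrite mulSn; lia.
have [||t e l] := loop n (set_reg s r 0); rewrite /= ?eqxx // ?[1 == r]eq_sym ?(negbTE r1) //.
exists (2 + t); last by lia.
exact: exec_seq (exec_set_reg s r (Const 0)) e.
Qed.

(** The base [n.+1] is positive, so the bounds for subprograms can be raised to a common
    exponent. *)
Lemma time_poly p : exists c d, forall n, time n p <= c * n.+1 ^ d.
Proof.
have mono n a b c : a <= c * n.+1 ^ b -> forall d, b <= d -> a <= c * n.+1 ^ d.
  by move=> h d bd; apply: leq_trans h _; rewrite leq_mul2l leq_pexp2l ?orbT.
elim: p => [|r e|a e1 e2|p [c1 [d1 h1]] q [c2 [d2 h2]]|e p [c1 [d1 h1]] q [c2 [d2 h2]]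
    |r p [c [d h]]] /=.
- by exists 1, 0 => n; rewrite expn0.
- by exists (cost e).+1, 0 => n; rewrite expn0 muln1.
- by exists (cost e1 + cost e2).+1, 0 => n; rewrite expn0 muln1.
- exists (c1 + c2), (d1 + d2) => n; rewrite mulnDl leq_add //.
    by apply: mono (h1 n) _ _; apply: leq_addr.
  by apply: mono (h2 n) _ _; apply: leq_addl.
- exists ((cost e).+1 + (c1 + c2)), (d1 + d2) => n; rewrite -addSn mulnDl leq_add //.
    by rewrite -{1}[_.+1]muln1 leq_mul2l expn_gt0 orbT.
  rewrite mulnDl leq_add //.
    by apply: mono (h1 n) _ _; apply: leq_addr.
  by apply: mono (h2 n) _ _; apply: leq_addl.
exists (c + 14), d.+1 => n; rewrite expnS.
have := h n; have : 0 < n.+1 ^ d by rewrite expn_gt0.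
by move: (time n p) (n.+1 ^ d) => t x; nia.
Qed.

Arguments run : simpl never.

Lemma run_seq n p q s : run n (PSeq p q) s = run n q (run n p s).
Proof. by []. Qed.

Lemma run_if n e p q s :
  run n (PIf e p q) s = if eval s e != 0 then run n p s else run n q s.
Proof. by []. Qed.

Lemma run_set_reg n r e s : run n (PReg r e) s = set_reg s r (eval s e).
Proof. by []. Qed.

Lemma run_set_arr n a e1 e2 s :
  run n (PArr a e1 e2) s = set_arr s a (eval s e1) (eval s e2).
Proof. by []. Qed.

Lemma run_skip n s : run n PSkip s = s.
Proof. by []. Qed.

Definition runE := (run_seq, run_if, run_set_reg, run_set_arr, run_skip).

Definition framed p s s' : Prop :=
  (forall r, r \notin regs_of p -> reg s' r = reg s r) /\
  (forall a, a \notin arrs_of p -> arr s' a = arr s a).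

(** The Hoare rule for loops. By [framed], whatever the loop does not write still has its value from
    the entry state [s], so [I] only has to mention what changes. *)
Lemma run_for n (I : nat -> state -> Prop) r p s :
    r \notin regs_of p ->
    I 0 (set_reg s r 0) ->
    (forall j s', j < n -> reg s' r = j -> framed (PFor r p) s s' -> I j s' ->
       I j.+1 (set_reg (run n p s') r j.+1)) ->
  I n (run n (PFor r p) s).
Proof.
move=> rp h0 hS; rewrite /run -/run.
pose f s := set_reg (run n p s) r (reg (run n p s) r + 1).
suff: forall m, m <= n -> let s' := iter m f (set_reg s r 0) in
    [/\ reg s' r = m, framed (PFor r p) s s' & I m s'].
  by case/(_ n (leqnn n)).
elim=> [|m IHm] mn s'; rewrite {}/s'.
  rewrite /= eqxx; split=> //; split=> // r' /=.
  by rewrite inE negb_or => /andP[/negbTE->].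
have [hr [h1 h2] hI] := IHm (ltnW mn); rewrite iterS; move: (iter m f _) hr h1 h2 hI => s' hr h1 h2 hI.
have -> : f s' = set_reg (run n p s') r m.+1 by rewrite /f run_reg // hr addn1.
split; [by rewrite /= eqxx | split | exact: hS].
  move=> r' /=; rewrite inE negb_or => /andP[rr' r'p].
  by rewrite (negbTE rr') run_reg // h1 //= inE negb_or rr'.
by move=> a ap; rewrite /= run_arr // h2.
Qed.

(** * Boolean tests as arithmetic expressions *)

Definition ENot e := Sub (Const 1) e.
Definition EAnd e1 e2 := ENot (Add (ENot e1) (ENot e2)).
Definition EEq e1 e2 := ENot (Add (Sub e1 e2) (Sub e2 e1)).

Lemma eval_not s e : eval s (ENot e) = (eval s e == 0) :> nat.
Proof. by rewrite /=; case: (eval s e). Qed.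

Lemma eval_and s e1 e2 : eval s (EAnd e1 e2) = (eval s e1 != 0) && (eval s e2 != 0) :> nat.
Proof.
by rewrite /=; case: (eval s e1) => [|?]; case: (eval s e2).
Qed.

Lemma eval_eq s e1 e2 : eval s (EEq e1 e2) = (eval s e1 == eval s e2) :> nat.
Proof. by rewrite /EEq eval_not /= addn_eq0 !subn_eq0 -eqn_leq. Qed.

Lemma eval_lt s e1 e2 : (eval s (Sub e2 e1) != 0) = (eval s e1 < eval s e2).
Proof. by rewrite /= subn_eq0 -ltnNge. Qed.

Lemma nat_of_bool_neq0 (b : bool) : (b != 0 :> nat) = b.
Proof. by case: b. Qed.

Definition evalE := (eval_and, eval_not, eval_eq, eval_lt, nat_of_bool_neq0).

(* Keeps [simpl] from expanding the Boolean connectives into arithmetic. *)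
Opaque ENot EAnd EEq.

(** * Elimination orders *)

Section Elimination.
Variables (T : finType) (pos : T -> nat).
Hypothesis pos_inj : injective pos.

Definition later (A : {set T}) (H : rel T) x :=
  [set y in A | (pos x < pos y) && H x y].

Definition elim_order (A : {set T}) (H : rel T) (k : nat) : Prop :=
  (forall x y z, x \in A -> y \in later A H x -> z \in later A H x ->
     pos y < pos z -> H y z) /\
  (forall x, x \in A ->
     (forall y, y \in A -> pos x < pos y -> H x y) \/ k <= #|later A H x|).

(** Each set of later neighbours loses at most [#|D|] members. *)
Lemma elim_orderD A H k (D : {set T}) :
  elim_order A H k -> elim_order (A :\: D) H (k - #|D|).
Proof.
case=> cl dg; split=> [x y z|x].
  rewrite !inE => /andP[_ xA] /andP[/andP[_ yA] hy] /andP[/andP[_ zA] hz].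
  by apply: (cl x); rewrite ?inE ?yA ?zA.
rewrite inE => /andP[_ xA]; case: (dg x xA) => [h|h]; [left|right].
  by move=> y; rewrite inE => /andP[_ yA]; exact: h.
have -> : later (A :\: D) H x = later A H x :\: D.
  by apply/setP => y; rewrite !inE -!andbA.
by rewrite cardsD leq_sub // subset_leq_card // subsetIr.
Qed.

(** Only earlier neighbours of [x] gain an edge to [y], because in an elimination order the later
    ones form a clique with [y] already. Edges are read from the earlier end to the later one, so
    one direction is recorded. *)
Definition contract (H : rel T) x y : rel T :=
  fun a b => H a b || [&& b == y, pos a < pos x & H a x].

(** An earlier neighbour [a] of [x] loses [x] and gains [y], which is new to it by the last
    hypothesis. Cliques survive: another later neighbour of [a] is adjacent to [x], so it gets an
    edge to [y] if it comes before [x], and otherwise lies in the clique of later neighbours of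
    [x]. *)
Lemma elim_order_contract A H k x y :
    elim_order A H k -> x \in A -> y \in later A H x ->
    (forall a, a \in A -> pos a < pos x -> H a x -> ~~ H a y) ->
  elim_order (A :\ x) (contract H x y) k.
Proof.
case=> cl dg xA; rewrite inE => /and3P[yA xy Hxy] first.
have {}cl a b c : a \in A -> b \in A -> c \in A -> pos a < pos b -> pos a < pos c ->
    H a b -> H a c -> pos b < pos c -> H b c.
  by move=> aA bA cA ab ac Hb Hc bc; apply: (cl a); rewrite ?inE ?bA ?cA ?ab ?ac.
split=> [a b c|a].
  rewrite !inE /contract => /andP[ax aA].
  move=> /and3P[/andP[bx bA] ab /orP Hb] /and3P[/andP[cx cA] ac /orP Hc] bc.
  have [ltax|leax] := ltnP (pos a) (pos x); last first.
    have Hb' : H a b by case: Hb => // /and3P[_]; rewrite ltnNge leax.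
    have Hc' : H a c by case: Hc => // /and3P[_]; rewrite ltnNge leax.
    by rewrite (cl a).
  have [Hax|NHax] := boolP (H a x); last first.
    have Hb' : H a b by case: Hb => // /and3P[_ _]; rewrite (negbTE NHax).
    have Hc' : H a c by case: Hc => // /and3P[_ _]; rewrite (negbTE NHax).
    by rewrite (cl a).
  have cla u : u != x -> u \in A -> pos a < pos u -> H a u ->
      if pos u < pos x then H u x else H x u.
    move=> ux uA au Hau; case: ltngtP => h.
    - by apply: (cl a).
    - by apply: (cl a).
    - by rewrite (pos_inj h) eqxx in ux.
  case: Hb => [Hb|/and3P[/eqP eby _ _]]; case: Hc => [Hc|/and3P[/eqP ecy _ _]].
  - by rewrite (cl a).
  - subst c; have := cla b bx bA ab Hb; case: ltngtP => h Hbx.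
    + by rewrite eqxx Hbx orbT.
    + by rewrite (cl x).
    + by rewrite (pos_inj h) eqxx in bx.
  - subst b; have := cla c cx cA ac Hc; case: ltngtP => h Hxc.
    + by have := ltn_trans xy (ltn_trans bc h); rewrite ltnn.
    + by rewrite (cl x).
    + by rewrite (pos_inj h) eqxx in cx.
  - by subst b c; rewrite ltnn in bc.
rewrite inE => /andP[ax aA]; rewrite inE in ax.
case: (dg a aA) => [h|h]; [left|right].
  by move=> b; rewrite !inE /contract => /andP[_ bA] /(h _ bA) ->.
apply: leq_trans h _.
have [/andP[ltax Hax]|N] := boolP ((pos a < pos x) && H a x); last first.
  apply: subset_leq_card; apply/subsetP => b; rewrite !inE /contract.
  case/and3P=> bA ab Hab; rewrite bA ab Hab !andbT.
  by apply: contraNneq N => <-; rewrite ab.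
have Nay := first a aA ltax Hax.
have xL : x \in later A H a by rewrite inE xA ltax.
have yL : y \in later (A :\ x) (contract H x y) a.
  rewrite !inE /contract eqxx yA Hax ltax (ltn_trans ltax xy) /= orbT !andbT.
  by apply: contraTneq xy => ->; rewrite ltnn.
(* [x] and [y] cancel in the two counts; all other later neighbours of [a] are kept. *)
rewrite (cardsD1 x) (cardsD1 y (later (_ :\ _) _ _)) xL yL leq_add2l.
apply: subset_leq_card; apply/subsetP => b; rewrite !inE /contract.
case/and4P=> bx bA ab Hab; rewrite bA bx ab Hab !andbT.
by apply: contraNneq Nay => <-.
Qed.

Variables (A : {set T}) (H : rel T) (p : T -> nat).

(** [p] numbers the parts from 1 and is 0 on unassigned vertices, so a nonzero value on [A] marks a
    terminal. *)
Definition mixed x y :=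
  [&& x \in A, y \in A, pos x < pos y, H x y & (p x == 0) != (p y == 0)].

Hypothesis elimA : elim_order A H #|[set x in A | p x != 0]|.

(* The later neighbours of [t] are terminals other than [t], hence too few for the
   second alternative in [elim_order]. *)
Lemma unmixed_complete t : t \in A -> p t != 0 -> (forall y, ~~ mixed t y) ->
  forall y, y \in A -> pos t < pos y -> H t y /\ p y != 0.
Proof.
move=> tA pt nm y yA ty.
have tm z : z \in A -> pos t < pos z -> H t z -> p z != 0.
  move=> zA tz Hz; move: (nm z); rewrite /mixed tA zA tz Hz (negbTE pt) /=.
  by case: (p z == 0).
case: elimA => _ /(_ t tA)[h|]; first by split; [exact: h | exact: tm (h _ _ _)].
rewrite leqNgt => /negP[]; apply: proper_card; apply/properP; split.
  by apply/subsetP=> z; rewrite !inE => /and3P[zA tz Hz]; rewrite zA (tm z).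
by exists t; rewrite !inE ?tA ?pt // ltnn.
Qed.

(** Without mixed edges only terminals follow [t], so the last unassigned vertex precedes [t]. Its
    later neighbours would all be unassigned, so it has none; but it must be adjacent to [t] or have
    at least as many later neighbours as there are terminals. *)
Lemma exists_mixed u t : u \in A -> p u = 0 -> t \in A -> p t != 0 ->
  exists x y, mixed x y.
Proof.
move=> uA pu tA pt.
suff: [exists x, exists y, mixed x y].
  by case/existsP=> x /existsP[y h]; exists x, y.
apply/negbNE/negP; rewrite negb_exists => /forallP nm0.
have nm x y : ~~ mixed x y by have := nm0 x; rewrite negb_exists => /forallP /(_ y).
have htA : (t \in A) && (p t != 0) by rewrite tA.
have htu : (u \in A) && (p u == 0) by rewrite uA pu /=.
case: (@arg_minnP _ t [pred z | (z \in A) && (p z != 0)] pos htA) => {uA pu}t' /andP[tA' pt'] _.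
case: (@arg_maxnP _ u [pred z | (z \in A) && (p z == 0)] pos htu) => u' /andP[uA /eqP pu] mx.
move: t' tA' pt' u' uA pu mx => {tA pt htA htu u}t tA pt u uA pu mx.
have comp := unmixed_complete tA pt (nm t).
have ut : pos u < pos t.
  case: ltngtP => // h; first by have [_] := comp u uA h; rewrite pu.
  by rewrite -(pos_inj h) pu in pt.
case: elimA => _ /(_ u uA)[h|].
  by have := nm u t; rewrite /mixed uA tA ut h // pu (negbTE pt).
rewrite leqNgt => /negP[]; rewrite (eq_card0 (A := later _ _ _)).
  by apply/card_gt0P; exists t; rewrite inE tA.
move=> z; rewrite !inE; apply/negP => /and3P[zA uz Hz].
have := nm u z; rewrite /mixed uA zA uz Hz pu /=.
case hz: (p z == 0) => // _; have := mx z; rewrite /= zA hz leqNgt uz.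
by move=> /(_ isT).
Qed.

(** By minimality no mixed edge starts at [a]. If [a] is unassigned, its neighbours [x] and [y]
    would be too; if [a] is a terminal, every later vertex is one. Either way [x y] would not be
    mixed. *)
Lemma first_mixed x y : mixed x y ->
    (forall x' y', mixed x' y' -> pos x <= pos x') ->
  forall a, a \in A -> pos a < pos x -> H a x -> ~~ H a y.
Proof.
case/and5P=> xA yA xy Hxy pxy mn a aA ax Hax; apply/negP => Hay.
have nm z : ~~ mixed a z by apply/negP => /mn; rewrite leqNgt ax.
have ay := ltn_trans ax xy.
have [pa|pa] := eqVneq (p a) 0.
  have := nm x; have := nm y; rewrite /mixed aA xA yA ax ay Hax Hay pa /=.
  by move: pxy; case: (p x == 0); case: (p y == 0).
have [_ px] := unmixed_complete aA pa nm xA ax.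
have [_ py] := unmixed_complete aA pa nm yA ay.
by move: pxy; rewrite (negbTE px) (negbTE py).
Qed.

End Elimination.

(** * Simplicial vertices, connectivity and interval graphs *)

Section Connectivity.
Variables (T : finType) (G : sgraph T).

Lemma induced_connectedU1 (A : {set T}) a v :
  induced_connected G A -> a \in A -> G v a -> induced_connected G (v |: A).
Proof.
move=> cA aA Gva; rewrite /induced_connected.
set e := [rel x y | _].
have es : connect_sym e.
  by apply: sym_connect_sym => x y /=; rewrite adj_sym; case: (x \in _); case: (y \in _).
have sub x y : x \in A -> y \in A -> connect e x y.
  move=> xA yA; apply: connect_sub (cA x y xA yA) => {}x {}y /= /and3P[{}xA {}yA xy].
  by apply: connect1; rewrite /= !inE xA yA xy !orbT.
have va : connect e v a by apply: connect1; rewrite /= !inE eqxx aA orbT.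
move=> x y /setU1P[->|xA] /setU1P[->|yA].
- exact: connect0.
- exact: connect_trans va (sub _ _ aA yA).
- by rewrite es; exact: connect_trans va (sub _ _ aA xA).
- exact: sub.
Qed.

Lemma induced_connected1 v : induced_connected G [set v].
Proof. by move=> x y /set1P-> /set1P->; exact: connect0. Qed.

Definition simplicial_in (A : {set T}) v :=
  forall a b, a \in A -> b \in A -> a != b -> G v a -> G v b -> G a b.

(** A walk can bypass [v], since the vertices before and after it are adjacent or equal. *)
Lemma induced_connectedD1 (A : {set T}) v :
  simplicial_in A v -> induced_connected G A -> induced_connected G (A :\ v).
Proof.
move=> sv cA x y /setD1P[xv xA] /setD1P[yv yA].
set e := [rel x y | _].
have /connectP[q pq ey] := cA x y xA yA.
(* For a walk that has just reached [v], the induction records that every neighbour of [v] can be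
   reached while avoiding [v]. *)
suff: (last x q != v -> connect e x (last x q)) /\
      (last x q = v -> forall w, w \in A -> G v w -> connect e x w).
  by case=> h _; rewrite ey h // -ey.
elim/last_ind: q pq {ey} => [|q z IHq] /=; first by split=> // h; rewrite h eqxx in xv.
rewrite rcons_path last_rcons => /andP[/IHq[IH1 IH2] /and3P[lA zA lz]]; split=> [zv|zv w wA vw].
  have [lv|lv] := eqVneq (last x q) v; first by apply: IH2; rewrite // -lv.
  apply: connect_trans (IH1 lv) (connect1 _).
  by rewrite /= !inE lv zv lA zA.
have lv : last x q != v by apply: contraTneq lz => ->; rewrite zv adj_irr.
apply: connect_trans (IH1 lv) _.
have [->|lw] := eqVneq (last x q) w; first exact: connect0.
apply: connect1; rewrite /= !inE lv lA wA (sv (last x q) w) // ?andbT.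
  by apply: contraTneq vw => ->; rewrite adj_irr.
by rewrite adj_sym -zv.
Qed.

(** If [x] has fewer than [k] later neighbours, deleting them isolates [x] in the tail of the order
    that starts at [x]. That tail stays connected, so it contains nothing else. *)
Lemma k_connected_elim_order (pos : T -> nat) k :
    injective pos -> 0 < k -> k_connected G k ->
    (forall v, simplicial_in [set a | pos v < pos a] v) ->
  elim_order pos setT G k.
Proof.
move=> pos_inj k0 [_ kc] sm.
(* Raising [m] by one removes one simplicial vertex from the tail or, if no vertex has position [m],
   nothing. *)
have tl m (S : {set T}) : #|S| < k -> induced_connected G ([set x | m <= pos x] :\: S).
  move=> Sk; elim: m => [|m IHm].
    have -> : [set x | 0 <= pos x] :\: S = ~: S by apply/setP => x; rewrite !inE andbT.
    by apply: kc; lia.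
  have [/existsP[v /eqP pv]|N] := boolP [exists v, pos v == m].
    have -> : [set x | m < pos x] :\: S = ([set x | m <= pos x] :\: S) :\ v.
      apply/setP => x; rewrite !inE ltn_neqAle -pv eq_sym (inj_eq pos_inj).
      by case: (x == v); case: (x \in S).
    apply: induced_connectedD1 IHm => a b; rewrite !inE -pv => /andP[_ ha] /andP[_ hb] ab va vb.
    have h c : pos v <= pos c -> G v c -> pos v < pos c.
      move=> vc Gvc; rewrite ltn_neqAle vc andbT; apply: contraTneq Gvc.
      by move/pos_inj=> ->; rewrite adj_irr.
    by apply: (sm v); rewrite ?inE ?h.
  have <- : [set x | m <= pos x] = [set x | m < pos x].
    apply/setP => x; rewrite !inE [in RHS]ltn_neqAle; move: N; rewrite negb_exists.
    by move/forallP/(_ x); rewrite eq_sym => ->.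
  exact: IHm.
split=> [x y z _|x _].
  rewrite !inE /= => /andP[xy Gxy] /andP[xz Gxz] yz.
  by apply: (sm x); rewrite ?inE //; apply: contraTneq yz => ->; rewrite ltnn.
have [|h] := leqP k #|later pos setT G x|; [by right | left=> y _ xy].
apply/negbNE/negP => nxy.
have := tl (pos x) _ h; move=> /(_ x y); rewrite !inE leqnn (ltnW xy) ltnn xy (negbTE nxy).
move=> /(_ isT isT) /connectP[[|z q]] /=; first by move=> _ e; rewrite e ltnn in xy.
case/andP=> /and3P[_]; rewrite !inE => /andP[nz xz] Gxz.
rewrite Gxz andbT -leqNgt in nz.
have /eqP/pos_inj e : pos z == pos x by rewrite eqn_leq nz.
by rewrite e adj_irr in Gxz.
Qed.

End Connectivity.

(** Take [v] with the leftmost right end. If [x <= y] are points of [J v] in [J a] and [J b], then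
    [y] is in [J a] too, which reaches at least as far right as [J v]. Right ends are compared as
    bounds, which tells open ends from closed ones. *)
Lemma interval_graph_simplicial (R : realType) (T : finType) (G : sgraph T) (A : {set T}) :
  interval_graph R G -> A != set0 -> exists2 v, v \in A & simplicial_in G A v.
Proof.
case=> J [_ adjJ] /set0Pn[v0 v0A].
pose right v := let: Interval _ r := J v in r.
case: (Order.TotalTheory.arg_minP (P := mem A) right v0A) => v vA minv; exists v => //.
have simp a b x y : a \in A -> b \in A -> a != b ->
    x \in J v -> x \in J a -> y \in J v -> y \in J b -> (x <= y)%O -> G a b.
  move=> aA bA ab xv xa yv yb xy; apply/adjJ => //; exists y; split=> //.
  move: xa yv (minv a aA); rewrite /right.
  case: (J a) (J v) => [la ra] [lv rv]; rewrite !itv_boundlr /=.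
  case/andP=> h1 _ /andP[_ h2] h3.
  rewrite (Order.POrderTheory.le_trans h1) /=; last by rewrite bnd_simp.
  exact: Order.POrderTheory.le_trans h2 h3.
move=> a b aA bA ab va vb.
have nva : v != a by apply: contraTneq va => ->; rewrite adj_irr.
have nvb : v != b by apply: contraTneq vb => ->; rewrite adj_irr.
case/(adjJ _ _ nva): va => x [xv xa]; case/(adjJ _ _ nvb): vb => y [yv yb].
have [xy|/Order.POrderTheory.ltW yx] := Order.TotalTheory.leP x y.
  exact: (simp _ _ x y).
by rewrite adj_sym; apply: (simp _ _ y x) => //; rewrite eq_sym.
Qed.

Lemma succ_ord k m : m <= k -> m != 0 -> exists i : 'I_k, m = i.+1.
Proof. by case: m => [//|m] mk _; exists (Ordinal mk). Qed.

(** * The invariant of the contraction process *)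

Section Invariant.
Variables (T : finType) (G : sgraph T) (k : nat).
Variables (term : 'I_k -> T) (sz : 'I_k -> nat) (pos : T -> nat).
Hypothesis pos_inj : injective pos.
Hypothesis sz_sum : \sum_i sz i = #|T|.

Definition part (p : T -> nat) (i : 'I_k) := [set z | p z == i.+1].

(** The vertices of [G] that [x] stands for after the contractions. *)
Definition cell (p : T -> nat) x := [set z | (z == x) || (p x != 0) && (p z == p x)].

(** [A] and [H] describe the contracted graph. A part in progress has one representative in [A] and
    a full part has none, so the bound in [inv_elim] is the number of parts in progress. [inv_edge]
    traces edges back to [G], which keeps growing parts connected there. *)
Record invariant (A : {set T}) (H : rel T) (p : T -> nat) : Prop := Invariant {
  inv_elim : elim_order pos A H #|[set x in A | p x != 0]|;
  inv_free : forall x, p x = 0 -> x \in A;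
  inv_rep : forall x y, x \in A -> y \in A -> p x != 0 -> p x = p y -> x = y;
  inv_edge : forall x y, x \in A -> y \in A -> pos x < pos y -> H x y ->
    exists a b, [/\ a \in cell p x, b \in cell p y & G a b];
  inv_bound : forall x, p x <= k;
  inv_part : forall i, [/\ #|part p i| <= sz i, term i \in part p i
                         & induced_connected G (part p i)];
  inv_full : forall i : 'I_k, #|part p i| < sz i -> exists2 x, x \in A & p x = i.+1;
  inv_live : forall x (i : 'I_k), x \in A -> p x = i.+1 -> #|part p i| < sz i }.

Lemma sum_parts (p : T -> nat) : (forall x, p x <= k) ->
  \sum_i #|part p i| = #|[set x | p x != 0]|.
Proof.
move=> pk; rewrite -sum1_card (eq_bigr (fun i : 'I_k => \sum_(x | p x == i.+1) 1)); last first.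
  by move=> i _; rewrite -sum1_card; apply: eq_bigl => x; rewrite inE.
rewrite (exchange_big_dep (fun x => p x != 0)) /=; last first.
  by move=> i x _ /eqP ->.
rewrite [RHS](eq_bigl (fun x => p x != 0)); last by move=> x; rewrite inE.
apply: eq_bigr => x px; have [i e] := succ_ord (pk x) px.
rewrite (big_pred1 i) // => j; rewrite e eqSS; exact: eq_sym.
Qed.

(** As [u] is unassigned and the sizes add up to [#|T|], some part lacks a vertex; its
    representative is the terminal needed in [exists_mixed]. *)
Lemma inv_exists_mixed A H p u :
  invariant A H p -> p u = 0 -> exists x y, mixed pos A H p x y.
Proof.
move=> I pu.
have [/existsP[i hi]|] := boolP [exists i, #|part p i| < sz i].
  have [t tA pt] := inv_full I hi.
  by apply: (exists_mixed pos_inj (inv_elim I) (inv_free I pu) pu tA); rewrite pt.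
rewrite negb_exists => /forallP h.
have: \sum_i sz i <= \sum_i #|part p i| by apply: leq_sum => i _; rewrite leqNgt.
rewrite sz_sum (sum_parts (inv_bound I)) leqNgt => /negP[].
rewrite -cardsT; apply: proper_card; apply/properP; split; first exact: subsetT.
by exists u; rewrite ?inE ?pu.
Qed.

(** No part exceeds its size and the totals agree, which forces equality in every term. *)
Lemma inv_complete A H p : invariant A H p -> (forall x, p x != 0) ->
  forall i, #|part p i| = sz i.
Proof.
move=> I hp i.
have h : forall i, true -> #|part p i| <= sz i ?= iff (#|part p i| == sz i).
  by move=> j _; split=> //; have [] := inv_part I j.
have [_] := leqif_sum h.
rewrite sz_sum (sum_parts (inv_bound I)).
have -> : [set x | p x != 0] = setT by apply/setP => x; rewrite !inE hp.
by rewrite cardsT eqxx => /esym/forallP /(_ i) /eqP.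
Qed.

(** One of [p x] and [p y] is 0, so their sum is the number of the growing part. Whichever end was
    the terminal, the later end [y] represents the part afterwards, unless the part is now full and
    [y] leaves [A] together with [x]. *)
Lemma inv_step A H p (A' : {set T}) H' p' x y (i : 'I_k) :
    invariant A H p -> mixed pos A H p x y ->
    (forall x' y', mixed pos A H p x' y' -> pos x <= pos x') ->
    p x + p y = i.+1 ->
    (forall z, p' z = if (z == x) || (z == y) then i.+1 else p z) ->
    H' =2 contract pos H x y ->
    (forall z, z \in A' =
       [&& z \in A, z != x & (z != y) || (#|part p i|.+1 < sz i)]) ->
  [/\ invariant A' H' p', #|part p' i| = #|part p i|.+1
     & #|[set z | p z == 0]| = #|[set z | p' z == 0]|.+1].
Proof.
move=> I mxy mn pi hp' hH' hA'.
have {hH'} -> : H' = contract pos H x y.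
  by apply: functional_extensionality => a; apply: functional_extensionality => b.
case/and5P: (mxy) => xA yA xy Hxy pxy.
have nxy : x != y by apply: contraTneq xy => ->; rewrite ltnn.
(* [u] is the unassigned end and [t] the terminal. *)
have [u [t [xt pu pt]]] : exists u t, [/\ (u = x /\ t = y) \/ (u = y /\ t = x),
    p u = 0 & p t = i.+1].
  have [ex|nx] := eqVneq (p x) 0.
    by exists x, y; split; [left | | rewrite -pi ex].
  have ey : p y = 0 by apply/eqP; move: pxy; rewrite (negbTE nx); case: (p y == 0).
  by exists y, x; split; [right | | rewrite -pi ey addn0].
have nut : u != t by apply: contra_eq_neq pu => ->; rewrite pt.
have tA : t \in A by case: xt => -[_ ->].
have uA : u \in A by case: xt => -[-> _].
have {hp'} hp' z : p' z = if z == u then i.+1 else p z.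
  rewrite hp'; have [->|zu] := eqVneq z u.
    by case: xt => -[-> _]; rewrite eqxx ?orbT.
  have [->|zt] := eqVneq z t; first by rewrite pt; case: ifP.
  by case: xt zu zt => -[-> ->] /negbTE-> /negbTE->.
have p'u : p' u = i.+1 by rewrite hp' eqxx.
have p't : p' t = i.+1 by rewrite hp' eq_sym (negbTE nut).
have p'x : p' x = i.+1 by case: xt => -[eu et]; rewrite -?eu -?et.
have p'y : p' y = i.+1 by case: xt => -[eu et]; rewrite -?eu -?et.
have p'n z : p z != 0 -> p' z = p z by rewrite hp'; case: (eqVneq z u) => // ->; rewrite pu.
have parti : part p' i = u |: part p i.
  by apply/setP=> z; rewrite !inE hp'; case: (eqVneq z u); rewrite ?eqxx.
have partj j : j != i -> part p' j = part p j.
  move=> ji; apply/setP=> z; rewrite !inE hp'; case: (eqVneq z u) => // ->.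
  by rewrite pu eqSS eq_sym (inj_eq val_inj) (negbTE ji).
have cparti : #|part p' i| = #|part p i|.+1 by rewrite parti cardsU1 inE pu.
have live : #|part p i| < sz i by have := inv_live I tA; move=> /(_ i pt).
have sub a : cell p a \subset cell p' a.
  apply/subsetP=> z; rewrite !inE => /orP[->//|/andP[pa /eqP pz]].
  by rewrite !p'n // pz // pa eqxx orbT.
have subx : cell p x \subset cell p' y.
  apply/subsetP=> z; rewrite !inE p'y => /orP[/eqP->|/andP[px /eqP pz]].
    by rewrite p'x eqxx orbT.
  by rewrite p'n pz // -(p'n x) // p'x eqxx orbT.
(* The contracted edge [x y] comes from an edge of [G] between [u] and the part of [t]. *)
have [c ci uc] : exists2 c, c \in part p i & G u c.
  have [a [b [ha hb Gab]]] := inv_edge I xA yA xy Hxy.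
  have cu : cell p u = [set u] by apply/setP=> z; rewrite !inE pu /= orbF.
  have ct : cell p t = part p i.
    by apply/setP=> z; rewrite !inE pt /=; case: (eqVneq z t) => // ->; rewrite pt eqxx.
  case: xt => -[eu et]; move: ha hb; rewrite -eu -et cu ct.
    by move=> /set1P<- hb; exists b.
  by move=> ha /set1P <-; exists a => //; rewrite adj_sym.
split=> //; last first.
  rewrite (cardsD1 u) inE pu eqxx add1n; congr _.+1; apply: eq_card => z.
  by rewrite !inE hp'; case: (eqVneq z u).
(* The number of terminals is unchanged: [y] is one now, in place of whichever of [x] and [y] was
   one before. *)
have el : elim_order pos (A :\ x) (contract pos H x y) #|[set z in A :\ x | p' z != 0]|.
  have -> : #|[set z in A :\ x | p' z != 0]| = #|[set z in A | p z != 0]|.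
    rewrite (cardsD1 y) [RHS](cardsD1 x) [in RHS](cardsD1 y) !inE xA yA p'y.
    rewrite (eq_sym y) nxy /= addnA; congr (_ + _).
      by move: pxy; case: (p x == 0); case: (p y == 0).
    apply: eq_card => z; rewrite !inE hp'.
    have [//|zy] := eqVneq z y; have [//|zx] := eqVneq z x.
    by case: xt => -[-> _]; rewrite (negbTE zx, negbTE zy).
  apply: elim_order_contract => //; first exact: inv_elim I.
    by rewrite inE yA xy.
  by have := first_mixed (inv_elim I) mxy mn.
have A'A z : z \in A' -> z \in A by rewrite hA' => /andP[].
have nuA' z : z \in A' -> p' z = i.+1 -> z = y /\ #|part p i|.+1 < sz i.
  rewrite hA' hp' => /and3P[zA zx zy]; have [zu _|zu pz] := eqVneq z u.
    case: xt => -[e1 e2]; first by rewrite zu e1 eqxx in zx.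
    by move: zy; rewrite zu e1 eqxx.
  have zt : z = t by apply: (inv_rep I); rewrite ?pz ?pt.
  case: xt => -[e1 e2]; last by rewrite zt e2 eqxx in zx.
  by move: zy; rewrite zt e2 eqxx.
split.
- have [ge|lt] := leqP (sz i) #|part p i|.+1; last first.
    have -> : A' = A :\ x by apply/setP => z; rewrite hA' lt orbT andbT !inE andbC.
    exact: el.
  (* A full part also costs the vertex [y], and with it one terminal. *)
  have -> : A' = A :\ x :\ y.
    by apply/setP=> z; rewrite hA' ltnNge ge orbF !inE; case: (z == x); case: (z == y); rewrite ?andbF ?andbT.
  have := elim_orderD [set y] el; rewrite cards1.
  have -> // : #|[set z in A :\ x | p' z != 0]| - 1 = #|[set z in A :\ x :\ y | p' z != 0]|.
  rewrite (cardsD1 y) !inE eq_sym nxy yA p'y /= addnC addnK; apply: eq_card => z.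
  by rewrite !inE !andbA.
- move=> z; rewrite hp'; case: (eqVneq z u) => // zu pz; rewrite hA' (inv_free I pz).
  have zt : z != t by apply: contra_eq_neq pz => ->; rewrite pt.
  by case: xt zu zt => -[-> ->] -> ->.
- move=> a b aA' bA' pa pab.
  have [e|ne] := eqVneq (p' a) i.+1.
    by have [-> _] := nuA' a aA' e; have [|-> _] := nuA' b bA'; rewrite -?pab.
  have au : a != u by apply: contra_neq ne => ->.
  have bu : b != u by apply: contra_neq ne => e; rewrite pab e.
  move: pa pab; rewrite !hp' (negbTE au) (negbTE bu).
  by apply: (inv_rep I); exact: A'A.
- move=> a b aA' bA' ab /orP[Hab|/and3P[/eqP by_ ax Hax]].
    have [c1 [c2 [h1 h2 h3]]] := inv_edge I (A'A _ aA') (A'A _ bA') ab Hab.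
    by exists c1, c2; split=> //; [exact: (subsetP (sub a)) | exact: (subsetP (sub b))].
  have [c1 [c2 [h1 h2 h3]]] := inv_edge I (A'A _ aA') xA ax Hax.
  by exists c1, c2; split=> //; [exact: (subsetP (sub a)) | rewrite by_; exact: (subsetP subx)].
- by move=> z; rewrite hp'; case: (eqVneq z u) => // _; exact: inv_bound I z.
- move=> j; have [le tj cj] := inv_part I j.
  have [e|ji] := eqVneq j i; last by rewrite partj.
  subst j; rewrite cparti live parti; split=> //; first by rewrite inE tj orbT.
  exact: induced_connectedU1 ci uc.
- move=> j; have [->|ji] := eqVneq j i.
    by rewrite cparti => lt; exists y => //; rewrite hA' yA lt orbT eq_sym nxy.
  rewrite partj // => /(inv_full I)[z zA pz]; exists z; last by rewrite p'n // pz.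
  have [zx zy] : z != x /\ z != y.
    split; apply: contra_neq ji => e; apply/val_inj/succn_inj; rewrite -pz e.
      by rewrite -p'x p'n // -e pz.
    by rewrite -p'y p'n // -e pz.
  by rewrite hA' zA zx zy.
move=> z j zA'; have [->|ji] := eqVneq j i.
  by move=> /(nuA' z zA')[_]; rewrite cparti.
rewrite partj // hp'; case: (eqVneq z u) => [_ [e]|_].
  by rewrite (val_inj e) eqxx in ji.
by apply: (inv_live I); exact: A'A.
Qed.

(** Only terminals of parts of size 1 are missing from [A]; deleting them lowers the bound [k] and
    the number of terminals alike. *)
Lemma inv_init (A : {set T}) (p : T -> nat) :
    injective term -> (forall i, 0 < sz i) ->
    elim_order pos setT G k ->
    (forall i, p (term i) = i.+1) ->
    (forall x, p x = 0 \/ exists i, x = term i) ->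
    (forall x, p x = 0 -> x \in A) ->
    (forall i, (term i \in A) = (1 < sz i)) ->
  invariant A G p.
Proof.
move=> tinj sz0 el pterm pn freeA termA.
have ptermE x (i : 'I_k) : p x = i.+1 -> x = term i.
  by case: (pn x) => [->//|[j ->]]; rewrite pterm => -[/val_inj ->].
have partE i : part p i = [set term i].
  by apply/setP=> x; rewrite !inE; apply/eqP/eqP => [/ptermE|->].
have pk x : p x <= k by case: (pn x) => [->//|[j ->]]; rewrite pterm.
split=> //.
- have AE : A = setT :\: ~: A by rewrite setTD setCK.
  have -> : #|[set x in A | p x != 0]| = k - #|~: A|; last first.
    by rewrite [A in elim_order _ A]AE; exact: elim_orderD.
  have cT : #|[set term i | i : 'I_k]| = k by rewrite card_imset // card_ord.
  have -> : [set x in A | p x != 0] = [set term i | i : 'I_k] :\: ~: A.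
    apply/setP=> x; rewrite !inE negbK; congr (_ && _).
    apply/idP/imsetP => [|[i _ ->]]; last by rewrite pterm.
    by case: (pn x) => [->//|[i ->]] _; exists i.
  rewrite cardsD cT; congr (_ - _).
  have /setIidPr -> // : ~: A \subset [set term i | i : 'I_k].
  apply/subsetP=> x; rewrite inE; case: (pn x) => [/freeA ->//|[i ->]] _.
  exact: imset_f.
- move=> x y _ _; case: (pn x) => [->//|[i ->]] _; rewrite pterm => /esym.
  by move/ptermE.
- by move=> x y _ _ _ Gxy; exists x, y; rewrite !inE !eqxx.
- move=> i; rewrite partE cards1 inE eqxx; split=> //; exact: induced_connected1.
- by move=> i; rewrite partE cards1 -termA => h; exists (term i).
by move=> x i xA /ptermE e; rewrite partE cards1 -termA -e.
Qed.

End Invariant.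

(** * The program *)

(* Array 0 holds the input, whose adjacency matrix is overwritten by that of the
   contracted graph; array 1 the row offsets [i * n]; array 2 the elimination
   order, numbered from 1; array 3 the part of a vertex, numbered from 1, with 0
   for unassigned vertices; array 4 is nonzero on vertices contracted or
   deleted; array 5 holds the number of vertices that a part still lacks.
   Register 1 holds [n] and register 2 holds [k]. *)
Definition edge x y := Get 0 (Add (Const 2) (Add (Get 1 x) y)).

(** The machine has no multiplication, so the products [i * n] are tabulated by repeated
    addition. *)
Definition offsets :=
  PFor 3 (PArr 1 (Add (Reg 3) (Const 1)) (Add (Get 1 (Reg 3)) (Reg 1))).

(** Looks for a reason why the vertex in register 4 is not simplicial among the unnumbered vertices;
    register 7 is the flag. *)
Definition search_obstruction :=
  PFor 5 (PFor 6 (PIf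
    (EAnd (EAnd (ENot (Get 2 (Reg 5))) (ENot (Get 2 (Reg 6))))
    (EAnd (ENot (EEq (Reg 5) (Reg 6)))
    (EAnd (EAnd (edge (Reg 4) (Reg 5)) (edge (Reg 4) (Reg 6)))
          (ENot (edge (Reg 5) (Reg 6))))))
    (PReg 7 (Const 1)) PSkip)).

Definition search_simplicial :=
  PSeq (PReg 8 (Const 0))
    (PFor 4 (PSeq (PReg 7 (Const 0)) (PSeq search_obstruction
       (PIf (EAnd (ENot (Reg 7)) (ENot (Get 2 (Reg 4))))
          (PReg 8 (Add (Reg 4) (Const 1))) PSkip)))).

Definition order_vertices :=
  PFor 3 (PSeq search_simplicial
    (PArr 2 (Sub (Reg 8) (Const 1)) (Add (Reg 3) (Const 1)))).

(** [Get 1 (Reg 1)] is [n * n], the length of the matrix to be skipped. *)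
Definition terminal_at := Get 0 (Add (Const 2) (Add (Get 1 (Reg 1)) (Reg 3))).
Definition size_at :=
  Get 0 (Add (Const 2) (Add (Get 1 (Reg 1)) (Add (Reg 2) (Reg 3)))).

(** Every loop makes [n] passes; the test on registers 2 and 3 confines the work to the first [k].
    The terminal itself takes one place of its part. *)
Definition place_terminals :=
  PFor 3 (PIf (Sub (Reg 2) (Reg 3))
    (PSeq (PArr 5 (Add (Reg 3) (Const 1)) (Sub size_at (Const 1)))
    (PSeq (PArr 3 terminal_at (Add (Reg 3) (Const 1)))
          (PArr 4 terminal_at (ENot (Get 5 (Add (Reg 3) (Const 1)))))))
    PSkip).

(** The last conjunct lets a pair through only if none was found so far (register 8) or its first
    end precedes the best one (register 6). *)
Definition mixed_test :=
  EAnd (EAnd (EAnd (ENot (Get 4 (Reg 4))) (ENot (Get 4 (Reg 5))))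
             (EAnd (Sub (Get 2 (Reg 5)) (Get 2 (Reg 4)))
                   (edge (Reg 4) (Reg 5))))
       (EAnd (ENot (EEq (ENot (Get 3 (Reg 4))) (ENot (Get 3 (Reg 5)))))
             (ENot (EAnd (Reg 8)
                         (ENot (Sub (Get 2 (Reg 6)) (Get 2 (Reg 4))))))).

Definition search_mixed :=
  PSeq (PReg 8 (Const 0))
    (PFor 4 (PFor 5 (PIf mixed_test
      (PSeq (PReg 8 (Const 1)) (PSeq (PReg 6 (Reg 4)) (PReg 7 (Reg 5))))
      PSkip))).

(** One of the two part numbers is 0, so the sum is the other. The final loop carries out [contract]
    on the matrix. *)
Definition merge :=
  PSeq (PReg 9 (Add (Get 3 (Reg 6)) (Get 3 (Reg 7))))
  (PSeq (PArr 3 (Reg 6) (Reg 9))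
  (PSeq (PArr 3 (Reg 7) (Reg 9))
  (PSeq (PArr 5 (Reg 9) (Sub (Get 5 (Reg 9)) (Const 1)))
  (PSeq (PArr 4 (Reg 6) (Const 1))
  (PSeq (PArr 4 (Reg 7) (ENot (Get 5 (Reg 9))))
  (PFor 4 (PIf (EAnd (Sub (Get 2 (Reg 6)) (Get 2 (Reg 4))) (edge (Reg 4) (Reg 6)))
     (PArr 0 (Add (Const 2) (Add (Get 1 (Reg 4)) (Reg 7))) (Const 1)) PSkip))))))).

(** A successful round assigns one vertex, so [n] rounds suffice; a round without a mixed edge
    leaves all arrays alone. *)
Definition grow_parts := PFor 3 (PSeq search_mixed (PIf (Reg 8) merge PSkip)).

(** The matrix in array 0 can be overwritten, as only arrays 1 and 3 are still read. *)
Definition write_output :=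
  PSeq (PFor 3 (PIf (Sub (Reg 2) (Reg 3))
     (PFor 4 (PArr 0 (Add (Get 1 (Reg 3)) (Reg 4))
                     (EEq (Get 3 (Reg 4)) (Add (Reg 3) (Const 1))))) PSkip))
  (PReg 0 (Get 1 (Reg 2))).

Definition solver :=
  PSeq (PReg 2 (Get 0 (Const 1)))
  (PSeq offsets (PSeq order_vertices (PSeq place_terminals
  (PSeq grow_parts write_output)))).

Lemma wf_solver : wf solver.
Proof. by []. Qed.

(** * Correctness of the subprograms *)

Lemma has_iotaS (P : pred nat) j : has P (iota 0 j.+1) = has P (iota 0 j) || P j.
Proof. by rewrite -[j.+1]addn1 iotaD has_cat /= orbF. Qed.

Lemma has_iotaP n (P : pred nat) : reflect (exists v : 'I_n, P v) (has P (iota 0 n)).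
Proof.
apply: (iffP hasP) => [[v]|[v Pv]].
  by rewrite mem_iota => /andP[_ vn] Pv; exists (Ordinal vn).
by exists (val v); rewrite // mem_iota leq0n add0n ltn_ord.
Qed.

Lemma nth_allpairs (S T R : Type) (f : S -> T -> R) x0 y0 z0 s t i j :
    i < size s -> j < size t ->
  nth z0 [seq f x y | x <- s, y <- t] (i * size t + j) = f (nth x0 s i) (nth y0 t j).
Proof.
elim: s i => [|x s IHs] [|i] //= is_ jt; rewrite nth_cat size_map.
  by rewrite mul0n add0n jt (nth_map y0).
by rewrite mulSn -addnA ltnNge leq_addr /= addKn IHs.
Qed.

Section Run.
Variable n : nat.

Definition row_offsets (s : state) := forall i, i <= n -> arr s 1 i = i * n.

Definition adjn (s : state) a b := arr s 0 (2 + (a * n + b)) != 0.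

Lemma offsets_correct s : reg s 1 = n -> arr s 1 0 = 0 -> row_offsets (run n offsets s).
Proof.
move=> r1 a0; apply: (run_for (I := fun j s' => forall i, i <= j -> arr s' 1 i = i * n)) => //.
  by move=> i; rewrite leqn0 => /eqP->.
move=> j s' jn r3 [fr _] IH i ij; rewrite !runE /= r3 addn1 fr // r1.
case: eqP => [->|ne]; first by rewrite IH // mulSn addnC.
by apply: IH; lia.
Qed.

Definition obstruction s v a b :=
  [&& arr s 2 a == 0, arr s 2 b == 0, a != b, adjn s v a, adjn s v b & ~~ adjn s a b].

Definition obstructed s v :=
  has (fun a => has (obstruction s v a) (iota 0 n)) (iota 0 n).

Lemma search_obstruction_correct s :
    row_offsets s -> reg s 4 < n -> reg s 7 = 0 ->
  (reg (run n search_obstruction s) 7 != 0) = obstructed s (reg s 4).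
Proof.
move=> off r4 r7; set v := reg s 4 in r4 *.
pose Q j := has (fun a => has (obstruction s v a) (iota 0 n)) (iota 0 j).
apply: (run_for (I := fun j s' => (reg s' 7 != 0) = Q j)) => //=; first by rewrite r7.
move=> j s1 jn r5 [fr fa] IH.
rewrite /= [Q _]has_iotaS -/(Q j).
apply: (run_for (I := fun l s' => (reg s' 7 != 0) = Q j || has (obstruction s v j) (iota 0 l))) => //.
  by rewrite /= orbF.
move=> l s2 ln r6 [fr2 fa2] IH2.
have r52 : reg s2 5 = j by rewrite fr2.
have r42 : reg s2 4 = v by rewrite fr2 // fr.
have a2 a : arr s2 a = arr s a by rewrite fa2 // fa.
rewrite has_iotaS orbA -IH2 !runE !evalE /= r52 r42 r6 !a2 !off ?(ltnW jn) ?(ltnW r4) //.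
rewrite /obstruction /adjn eqb0 !negbK -!andbA.
by case: ifP => _ /=; rewrite ?orbT ?orbF.
Qed.

Definition free_simplicial s v := (arr s 2 v == 0) && ~~ obstructed s v.

(* [m] is one more than a free simplicial vertex, or 0 if there is none below [j]. *)
Definition located s j m :=
  if m is v.+1 then (v < n) && free_simplicial s v
  else ~~ has (free_simplicial s) (iota 0 j).

Lemma search_simplicial_correct s :
    row_offsets s ->
  located s n (reg (run n search_simplicial s) 8).
Proof.
move=> off; rewrite /search_simplicial run_seq.
apply: (run_for (I := fun j s' => located s j (reg s' 8))) => //.
move=> j s1 jn r4 [fr fa] IH; rewrite !runE.
set s2 := set_reg s1 7 _; set s3 := run n _ s2.
have a2 a : arr s2 a = arr s a by rewrite /s2 /= fa.
have a3 a : arr s3 a = arr s a by rewrite /s3 run_arr.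
have ob : (reg s3 7 != 0) = obstructed s j.
  rewrite search_obstruction_correct //= ?r4 //.
    by rewrite /obstructed /obstruction /adjn !a2.
  by move=> i; rewrite a2; exact: off.
have r43 : reg s3 4 = j by rewrite /s3 run_reg.
have r83 : reg s3 8 = reg s1 8 by rewrite /s3 run_reg.
rewrite !evalE /= r43 a3 -[reg s3 7 == 0]negbK ob andbC -/(free_simplicial s j).
case: ifP => h /=; first by rewrite addn1 /located jn.
by rewrite r83; move: IH; rewrite /located has_iotaS h orbF.
Qed.

Variable G : sgraph 'I_n.

(** Unnumbered vertices have [pos] 0 but will come after the numbered ones, hence the disjunction in
    [ordered_simplicial]. *)
Record ordered (t : nat) (pos : nat -> nat) : Prop := Ordered {
  ordered_le : forall v : 'I_n, pos v <= t;
  ordered_inj : forall u v : 'I_n, pos u != 0 -> pos u = pos v -> u = v;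
  ordered_card : #|[set v : 'I_n | pos v == 0]| = n - t;
  ordered_simplicial : forall v : 'I_n, pos v != 0 ->
    simplicial_in G [set a : 'I_n | (pos a == 0) || (pos v < pos a)] v }.

Lemma ordered_step t (pos pos' : nat -> nat) (v : 'I_n) :
    ordered t pos -> pos v = 0 -> simplicial_in G [set a : 'I_n | pos a == 0] v ->
    (forall u : 'I_n, pos' u = if u == v then t.+1 else pos u) ->
  ordered t.+1 pos'.
Proof.
case=> le inj cd sm pv sv hp'.
have np u : u != v -> pos' u = pos u by rewrite hp' => /negbTE->.
have pv' : pos' v = t.+1 by rewrite hp' eqxx.
split.
- by move=> u; rewrite hp'; case: eqP => // _; exact: leqW.
- move=> a b; have [->|av] := eqVneq a v.
    have [->//|bv] := eqVneq b v; rewrite pv' (np b) // => _ e.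
    by have := le b; rewrite -e ltnn.
  rewrite (np a) //; have [->|bv] := eqVneq b v; last by rewrite (np b) //; exact: inj.
  by rewrite pv' => _ e; have := le a; rewrite e ltnn.
- rewrite subnS -cd [in RHS](cardsD1 v) inE pv eqxx; apply: eq_card => u.
  by rewrite !inE hp'; case: (u == v).
- move=> a; have [->|av] := eqVneq a v.
    (* No number exceeds [t.+1], so only unnumbered vertices come after [v]. *)
    have late (b : 'I_n) : (pos' b == 0) || (t.+1 < pos' b) -> pos b == 0.
      rewrite hp'; case: (eqVneq b v) => [-> _|_]; first by rewrite pv.
      by case/orP=> // h; have := le b; lia.
    by move=> _ b c; rewrite !inE pv' => /late hb /late hc; apply: sv; rewrite inE.
  rewrite (np a) // => pa b c; rewrite !inE => hb hc; apply: sm pa _ _ _ _; rewrite inE.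
    by move: hb; rewrite hp'; case: (eqVneq b v) => [->|//]; rewrite pv.
  by move: hc; rewrite hp'; case: (eqVneq c v) => [->|//]; rewrite pv.
Qed.

Lemma order_vertices_correct s :
    row_offsets s -> (forall v : 'I_n, arr s 2 v = 0) ->
    (forall u v : 'I_n, adjn s u v = G u v) ->
    (forall A : {set 'I_n}, A != set0 -> exists2 v, v \in A & simplicial_in G A v) ->
  let pos (v : 'I_n) := arr (run n order_vertices s) 2 v in
  injective pos /\ (forall v, simplicial_in G [set a | pos v < pos a] v).
Proof.
move=> off pos0 adjG chordal.
have [_ inj cd sm] : ordered n (arr (run n order_vertices s) 2).
  apply: (run_for (I := fun t s' => ordered t (arr s' 2))) => //.
    split=> /=; first by move=> v; rewrite pos0.
    - by move=> u v; rewrite pos0.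
    - rewrite subn0 -[RHS](card_ord n) -cardsT; apply: eq_card => v.
      by rewrite !inE pos0.
    by move=> v; rewrite pos0.
  move=> t s1 tn r3 [fr fa] I1.
  have off1 : row_offsets s1 by move=> i; rewrite fa //; exact: off.
  have adj1 (u v : 'I_n) : adjn s1 u v = G u v by rewrite -adjG /adjn fa.
  have sgood (v : 'I_n) : free_simplicial s1 v <->
      arr s1 2 v = 0 /\ simplicial_in G [set a : 'I_n | arr s1 2 a == 0] v.
    rewrite /free_simplicial /obstructed; split.
      case/andP=> /eqP pv nob; split=> // a b; rewrite !inE => pa pb ab va vb.
      apply: contraNT nob => nab; apply/has_iotaP; exists a; apply/has_iotaP; exists b.
      by rewrite /obstruction pa pb ab !adj1 va vb nab.
    case=> -> sv; rewrite eqxx /=; apply/has_iotaP => -[a /has_iotaP[b]].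
    by rewrite /obstruction !adj1 => /and5P[pa pb ab va /andP[vb /negP[]]]; apply: sv; rewrite ?inE.
  have := search_simplicial_correct off1; rewrite !runE /=.
  set s2 := run n search_simplicial s1.
  have a2 : arr s2 2 = arr s1 2 by rewrite /s2 run_arr.
  have r32 : reg s2 3 = t by rewrite /s2 run_reg.
  case: (reg s2 8) => [/negP[]|v /andP[vn /(sgood (Ordinal vn))[pv sv]]].
    (* The answer 0 is impossible: unnumbered vertices remain because [t < n], and one of them is
       simplicial among these. *)
    have [|v] := chordal [set a : 'I_n | arr s1 2 a == 0].
      by rewrite -card_gt0 (ordered_card I1) subn_gt0.
    rewrite inE => /eqP pv sv; apply/has_iotaP; exists v; exact/sgood.
  apply: (ordered_step I1 pv sv) => u; rewrite /= r32 a2 subn1 addn1 /=.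
  by rewrite -val_eqE.
have pn (v : 'I_n) : arr (run n order_vertices s) 2 v != 0.
  move: cd; rewrite subnn => /cards0_eq/setP/(_ v); rewrite !inE => ->//.
split=> [u v|v a b]; first exact: inj.
by rewrite !inE => va vb; apply: (sm v (pn v)); rewrite inE ?va ?vb orbT.
Qed.

Lemma row_eq a b c d : b < n -> d < n -> (a * n + b == c * n + d) = (a == c) && (b == d).
Proof.
move=> bn dn; apply/eqP/andP => [e|[/eqP-> /eqP->] //].
have n0 : 0 < n by case: n bn.
have := congr1 (divn^~ n) e; rewrite !divnMDl // !divn_small // !addn0 => ac.
by move: e; rewrite ac => /addnI->; rewrite !eqxx.
Qed.

Lemma place_terminals_correct s k (term : 'I_k -> 'I_n) (sz : 'I_k -> nat) :
    injective term -> reg s 1 = n -> reg s 2 = k -> k <= n -> row_offsets s ->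
    (forall i : 'I_k, arr s 0 (2 + (n * n + i)) = term i) ->
    (forall i : 'I_k, arr s 0 (2 + (n * n + (k + i))) = sz i) ->
    (forall v : 'I_n, arr s 3 v = 0) -> (forall v : 'I_n, arr s 4 v = 0) ->
  let s' := run n place_terminals s in
  (forall i : 'I_k, [/\ arr s' 5 i.+1 = sz i - 1, arr s' 3 (term i) = i.+1
               & arr s' 4 (term i) = (sz i <= 1)]) /\
  (forall v : 'I_n, arr s' 3 v = 0 /\ arr s' 4 v = 0 \/ exists i, v = term i).
Proof.
move=> tinj r1 r2 kn off aT aS a3 a4.
(* The loop rule bounds [i] by the number [n] of passes, which is at least [k]. *)
suff [h1 h2] : (forall i : 'I_k, i < n ->
      [/\ arr (run n place_terminals s) 5 i.+1 = sz i - 1,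
          arr (run n place_terminals s) 3 (term i) = i.+1
        & arr (run n place_terminals s) 4 (term i) = (sz i <= 1)]) /\
    (forall v : 'I_n, arr (run n place_terminals s) 3 v = 0 /\
       arr (run n place_terminals s) 4 v = 0 \/ exists i, v = term i).
  by split=> // i; apply: h1; exact: leq_trans (ltn_ord i) kn.
apply: (run_for (I := fun j s' => (forall i : 'I_k, i < j ->
      [/\ arr s' 5 i.+1 = sz i - 1, arr s' 3 (term i) = i.+1
        & arr s' 4 (term i) = (sz i <= 1)]) /\
    (forall v : 'I_n, arr s' 3 v = 0 /\ arr s' 4 v = 0 \/ exists i, v = term i))) => //.
  by split=> // v; left; rewrite /= a3 a4.
move=> j s1 jn r3 [fr fa] [IH1 IH2]; rewrite runE evalE /=.
have [r1' r2'] : reg s1 1 = n /\ reg s1 2 = k by rewrite !fr.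
rewrite r3 r2'; have [jk|kj] := ltnP j k; last first.
  by split=> // i ij; apply: IH1; have := ltn_ord i; lia.
have eT : eval s1 terminal_at = term (Ordinal jk).
  by rewrite /= r1' r3 !fa // off // (aT (Ordinal jk)).
have eS : eval s1 size_at = sz (Ordinal jk).
  by rewrite /= r1' r2' r3 !fa // off // (aS (Ordinal jk)).
rewrite !runE [eval s1 (Sub _ _)]/(eval s1 size_at - 1) eS; set s2 := set_arr s1 5 _ _.
have eT2 : eval s2 terminal_at = term (Ordinal jk) by rewrite -eT.
rewrite eT2; set s3 := set_arr s2 3 _ _.
have eT3 : eval s3 terminal_at = term (Ordinal jk) by rewrite -eT.
rewrite eT3 evalE /= r3 addn1 eqxx subn_eq0.
split=> [i ij|v].
  have [e|ne] := eqVneq i (Ordinal jk); first by rewrite e !eqxx.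
  have /negbTE ne1 : val i != j by [].
  rewrite eqSS ne1 !(inj_eq val_inj) (inj_eq tinj) (negbTE ne).
  by apply: IH1; move: ij; rewrite ltnS leq_eqVlt ne1.
have [->|ne] := eqVneq v (term (Ordinal jk)); first by right; exists (Ordinal jk).
by rewrite !(inj_eq val_inj) (negbTE ne); exact: IH2.
Qed.

Definition mixedn s x y :=
  [&& arr s 4 x == 0, arr s 4 y == 0, arr s 2 x < arr s 2 y, adjn s x y
    & (arr s 3 x == 0) != (arr s 3 y == 0)].

(** [seen] is the set of pairs scanned so far; as a parameter it lets both nested loops share one
    invariant. *)
Definition best_mixed s (seen : rel nat) s' : Prop :=
  (reg s' 8 = 0 -> forall x y, x < n -> y < n -> seen x y -> ~~ mixedn s x y) /\
  (reg s' 8 != 0 -> [/\ reg s' 6 < n, reg s' 7 < n, mixedn s (reg s' 6) (reg s' 7)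
     & forall x y, x < n -> y < n -> seen x y -> mixedn s x y ->
         arr s 2 (reg s' 6) <= arr s 2 x]).

Lemma eq_best_mixed s (seen seen' : rel nat) s' :
    (forall x y, x < n -> y < n -> seen' x y -> seen x y) ->
  best_mixed s seen s' -> best_mixed s seen' s'.
Proof.
move=> h [b1 b2]; split=> [r8 x y xn yn /(h x y xn yn)|r8]; first exact: b1.
have [x6 x7 m b3] := b2 r8; split=> // x y xn yn /(h x y xn yn); exact: b3.
Qed.

Lemma search_mixed_correct s :
  row_offsets s -> best_mixed s (fun _ _ => true) (run n search_mixed s).
Proof.
move=> off; rewrite /search_mixed run_seq.
apply: (eq_best_mixed (seen := fun x y => x < n)) => //.
apply: (run_for (I := fun j s' => best_mixed s (fun x y => x < j) s')) => //.
move=> j s1 jn r4 [fr fa] IH.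
have off1 : row_offsets s1 by move=> i; rewrite fa //; exact: off.
apply: (eq_best_mixed (seen := fun x y => (x < j) || (x == j) && (y < n))).
  by move=> x y xn yn; rewrite ltnS leq_eqVlt yn andbT orbC.
rewrite /best_mixed /=.
apply: (run_for (I := fun l s' => best_mixed s (fun x y => (x < j) || (x == j) && (y < l)) s')) => //.
  by apply: eq_best_mixed IH => x y _ _; rewrite ltn0 andbF orbF.
move=> l s2 ln r5 [fr2 fa2] [b1 b2].
have r42 : reg s2 4 = j by rewrite fr2.
have a2 a : arr s2 a = arr s a by rewrite fa2 // fa.
have split_seen x y : (x < j) || (x == j) && (y < l.+1) ->
    (x < j) || (x == j) && (y < l) \/ x = j /\ y = l.
  case/orP=> [->|/andP[/eqP-> ]]; first by left.
  by rewrite ltnS leq_eqVlt => /orP[/eqP->|->]; [right | left; rewrite eqxx orbT].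
have cond : (eval s2 mixed_test != 0) =
    mixedn s j l && ((reg s2 8 == 0) || (arr s 2 j < arr s 2 (reg s2 6))).
  rewrite /mixed_test !evalE /= r42 r5 !a2 off ?(ltnW jn) // /mixedn /adjn.
  rewrite !eqb0 !negb_and negbK -[arr _ _ _ - _ != 0]lt0n subn_gt0 -!andbA.
  by case: (arr s 3 j == 0); case: (arr s 3 l == 0).
rewrite runE cond /best_mixed /=; case: ifP => [/andP[mjl best]|nb]; rewrite ?runE /=.
  split=> // _; rewrite r42 r5; split=> // x y xn yn /split_seen[sxy mxy|[-> _ _]] //.
  have [r8|r8] := eqVneq (reg s2 8) 0; first by have := b1 r8 x y xn yn sxy; rewrite mxy.
  have [_ _ _ b3] := b2 r8; apply: leq_trans (b3 x y xn yn sxy mxy).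
  by move: best; rewrite (negbTE r8) => /ltnW.
split=> [r8 x y xn yn /split_seen[|[-> ->]]|r8]; first exact: b1.
  by move: nb; rewrite r8 eqxx andbT => ->.
have [x6 x7 m b3] := b2 r8; split=> // x y xn yn /split_seen[|[-> ->] mjl]; first exact: b3.
by move: nb; rewrite mjl (negbTE r8) /= ltnNge => /negbFE.
Qed.

Lemma merge_correct s x y :
    row_offsets s -> reg s 6 = x -> reg s 7 = y -> x < n -> y < n -> x != y ->
  let s' := run n merge s in let q := arr s 3 x + arr s 3 y in
  [/\ forall z, arr s' 3 z = if (z == x) || (z == y) then q else arr s 3 z,
      forall i, arr s' 5 i = if i == q then arr s 5 q - 1 else arr s 5 i,
      forall z, arr s' 4 z = if z == y then nat_of_bool (arr s 5 q <= 1)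
                             else if z == x then 1 else arr s 4 z
    & forall a b, a < n -> b < n ->
      adjn s' a b = adjn s a b || [&& b == y, arr s 2 a < arr s 2 x & adjn s a x]].
Proof.
move=> off r6 r7 xn yn xy s' q.
rewrite /s' /merge 6!run_seq !run_set_reg !run_set_arr.
set s1 := set_arr _ 4 _ (eval _ (ENot _)).
have [a3 a5 a4] : [/\ forall z, arr s1 3 z = if (z == x) || (z == y) then q else arr s 3 z,
      forall i, arr s1 5 i = if i == q then arr s 5 q - 1 else arr s 5 i
    & forall z, arr s1 4 z = if z == y then nat_of_bool (arr s 5 q <= 1)
                             else if z == x then 1 else arr s 4 z].
  rewrite /s1 eval_not /= r6 r7 -/q !eqxx subn_eq0; split=> // z.
  by case: (z == x); case: (z == y).
have [a1 a2 a0] : [/\ arr s1 1 = arr s 1, arr s1 2 = arr s 2 & arr s1 0 = arr s 0] by [].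
have [r61 r71] : reg s1 6 = x /\ reg s1 7 = y by [].
clearbody s1; rewrite run_arr // run_arr // run_arr //; split=> // a b an bn.
suff : adjn (run n (PFor 4 (PIf (EAnd (Sub (Get 2 (Reg 6)) (Get 2 (Reg 4)))
         (edge (Reg 4) (Reg 6)))
       (PArr 0 (Add (Const 2) (Add (Get 1 (Reg 4)) (Reg 7))) (Const 1)) PSkip)) s1) a b =
   adjn s a b || [&& a < n, b == y, arr s 2 a < arr s 2 x & adjn s a x] by rewrite an.
apply: (run_for (I := fun j s' => forall a b, a < n -> b < n -> adjn s' a b =
  adjn s a b || [&& a < j, b == y, arr s 2 a < arr s 2 x & adjn s a x])) an bn => //.
  by move=> a' b' _ _; rewrite ltn0 orbF /adjn /= a0.
move=> j s2 jn r4 [fr fa] IH a' b' an bn.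
have r62 : reg s2 6 = x by rewrite fr.
have r72 : reg s2 7 = y by rewrite fr.
have a22 : arr s2 2 = arr s 2 by rewrite fa.
have a12 : arr s2 1 j = j * n by rewrite fa // a1 off // ltnW.
(* The passes before [j] only write in rows before [j]. *)
have jx : adjn s2 j x = adjn s j x by rewrite IH // ltnn orbF.
rewrite runE !evalE /= r4 r62 a12 a22 -/(adjn s2 j x) jx.
case: ifP => [/andP[p2 p3]|np].
  rewrite runE /= r4 r72 a12 /adjn /= -/(2 + _) !eqn_add2l row_eq //.
  rewrite -/(adjn s a' b') -/(adjn s a' x).
  case: ifP => [/andP[/eqP-> /eqP->]|nab]; first by rewrite ltnSn eqxx p2 p3 orbT.
  rewrite -/(adjn s2 a' b') IH //; congr (_ || _); rewrite ltnS [a' <= j]leq_eqVlt.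
  by move: nab; case: (a' == j) => //=; case: (b' == y) => //=; rewrite andbF.
rewrite runE [adjn _ a' b'](_ : _ = adjn s2 a' b') // IH //; congr (_ || _).
rewrite ltnS [a' <= j]leq_eqVlt; have [->|//] := eqVneq a' j.
by rewrite ltnn np andbF.
Qed.

Definition alive s := [set v : 'I_n | arr s 4 v == 0].
Definition placed s (v : 'I_n) := arr s 3 v.
Definition adjo s (u v : 'I_n) := adjn s u v.

Definition state_inv k (term : 'I_k -> 'I_n) (sz : 'I_k -> nat) (pos : 'I_n -> nat) s : Prop :=
  [/\ invariant G term sz pos (alive s) (adjo s) (placed s),
      forall v : 'I_n, arr s 2 v = pos v
    & forall i : 'I_k, arr s 5 i.+1 = sz i - #|part (placed s) i|].

Lemma eq_state_inv k (term : 'I_k -> 'I_n) sz pos s s' :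
  (forall a, arr s' a = arr s a) -> state_inv term sz pos s -> state_inv term sz pos s'.
Proof. by move=> e; rewrite /state_inv /alive /placed /adjo /adjn !e. Qed.

Lemma state_step k (term : 'I_k -> 'I_n) sz (pos : 'I_n -> nat) s :
    injective pos -> row_offsets s -> state_inv term sz pos s -> reg s 8 != 0 ->
    best_mixed s (fun _ _ => true) s ->
  state_inv term sz pos (run n merge s) /\
  #|[set v | placed s v == 0]| = #|[set v | placed (run n merge s) v == 0]|.+1.
Proof.
move=> pos_inj off [I P R] r8 [_ /(_ r8)[xn yn mxy mn]].
pose x := Ordinal xn; pose y := Ordinal yn.
have mixE (u v : 'I_n) : mixedn s u v = mixed pos (alive s) (adjo s) (placed s) u v.
  by rewrite /mixed !inE -!P.
have nxy : reg s 6 != reg s 7.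
  by case/and5P: mxy => _ _ lt _ _; apply: contraTneq lt => ->; rewrite ltnn.
have [i qi] : exists i : 'I_k, placed s x + placed s y = i.+1.
  have := inv_bound I x; have := inv_bound I y; case/and5P: mxy => _ _ _ _.
  rewrite -/(placed s x) -/(placed s y).
  by case: (placed s x) => [|a]; case: (placed s y) => [|b] //= _ hb ha;
    apply: succ_ord; rewrite ?addn0.
case: (merge_correct off erefl erefl xn yn nxy).
set s' := run n merge s; rewrite -/(placed s x) -/(placed s y) qi => m3 m5 m4 m0.
have mxy' : mixed pos (alive s) (adjo s) (placed s) x y by rewrite -mixE.
have mn' x' y' : mixed pos (alive s) (adjo s) (placed s) x' y' -> pos x <= pos x'.
  by rewrite -mixE -!P; apply: mn.
have hp z : placed s' z = if (z == x) || (z == y) then i.+1 else placed s z by apply: m3.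
have hH : adjo s' =2 contract pos (adjo s) x y.
  by move=> a b; rewrite /contract -!P; apply: m0.
have Ri := R i; have live : #|part (placed s) i| < sz i.
  have [pxy|pxy] := eqVneq (placed s x) 0.
    by have := inv_live I (x := y) (i := i); rewrite -qi pxy; apply=> //; case/and5P: mxy'.
  have py : placed s y = 0.
    by case/and5P: mxy' => _ _ _ _; rewrite (negbTE pxy); case: (eqVneq (placed s y) 0).
  by have := inv_live I (x := x) (i := i); rewrite -qi py addn0; apply=> //; case/and5P: mxy'.
have hA z : (z \in alive s') = [&& z \in alive s, z != x & (z != y) || (#|part (placed s) i|.+1 < sz i)].
  have zx0 : (val z == reg s 6) = (z == x) by rewrite -val_eqE.
  have zy0 : (val z == reg s 7) = (z == y) by rewrite -val_eqE.
  rewrite !inE m4 zx0 zy0.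
  have [->|zy] := eqVneq z y; last by case: (eqVneq z x) => _; rewrite ?andbT ?andbF.
  have [yA yx] : y \in alive s /\ y != x by case/and5P: mxy' => _ -> _ _ _; rewrite eq_sym.
  by move: yA; rewrite inE yx => ->; rewrite Ri eqb0 -ltnNge; lia.
have [I' c' u'] := inv_step pos_inj I mxy' mn' qi hp hH hA.
split=> //; split=> // [v|j]; first by rewrite -P /s' run_arr.
rewrite m5 eqSS; have [e|ji] := eqVneq (j : nat) i.
  by rewrite (val_inj e) c' Ri; lia.
rewrite R; congr (_ - _); apply: eq_card => z; rewrite !inE hp.
have nij : (i.+1 == j.+1) = false by rewrite eqSS eq_sym; exact/negbTE.
case: ifP => // xyz; rewrite nij.
(* Before the step [x] and [y] were unassigned or in part [i], so the other parts do not change. *)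
have pi0 : placed s z = 0 \/ placed s z = i.+1.
  have pxy : placed s x = 0 \/ placed s y = 0.
    case/and5P: mxy' => _ _ _ _; case: (eqVneq (placed s x) 0); first by left.
    by case: (eqVneq (placed s y) 0); first by right.
  by case/orP: xyz => /eqP->; move: qi; case: pxy => ->; rewrite ?addn0; tauto.
by case: pi0 => ->; rewrite ?nij.
Qed.

Lemma grow_parts_correct s k (term : 'I_k -> 'I_n) (sz : 'I_k -> nat) (pos : 'I_n -> nat) :
    injective pos -> \sum_i sz i = n -> row_offsets s ->
    state_inv term sz pos s ->
  let s' := run n grow_parts s in
  state_inv term sz pos s' /\ forall v, placed s' v != 0.
Proof.
move=> pos_inj sz_sum off I0 s'.
have sumT : \sum_i sz i = #|'I_n| by rewrite card_ord.
have [I c0] : state_inv term sz pos s' /\ #|[set v | placed s' v == 0]| <= n - n.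
  apply: (run_for (I := fun t s' => state_inv term sz pos s' /\
    #|[set v | placed s' v == 0]| <= n - t)) => //.
    by split=> //; rewrite subn0 -[leqRHS](card_ord n) max_card.
  move=> {s'} t s1 tn r3 [fr fa] [I1 c1]; rewrite run_seq.
  have off1 : row_offsets s1 by move=> i; rewrite fa //; exact: off.
  have := search_mixed_correct off1; set s2 := run n search_mixed s1.
  have a2 a : arr s2 a = arr s1 a by rewrite /s2 run_arr.
  have off2 : row_offsets s2 by move=> i; rewrite a2; exact: off1.
  have I2 := eq_state_inv a2 I1.
  have -> : best_mixed s1 (fun _ _ => true) s2 = best_mixed s2 (fun _ _ => true) s2.
    by rewrite /best_mixed /mixedn /adjn !a2.
  move=> best; have c2 : #|[set v | placed s2 v == 0]| <= n - t by rewrite /placed a2.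
  rewrite runE /=; case: ifP => [r8|/negbFE/eqP r8].
    have [I3 c3] := state_step pos_inj off2 I2 r8 best.
    split; first by apply: eq_state_inv I3.
    suff : #|[set v | placed (run n merge s2) v == 0]| <= n - t.+1 by [].
    by move: c2; rewrite c3; lia.
  split; first by apply: eq_state_inv I2.
  (* By [inv_exists_mixed], a failed search means that every vertex is assigned. *)
  rewrite runE (_ : #|_| = 0) //; apply: eq_card0 => v; rewrite !inE; apply/eqP => pv.
  have [I P _] := I2; have [x [y mxy]] := inv_exists_mixed pos_inj sumT I pv.
  have [none _] := best.
  have /negP[] := none r8 x y (ltn_ord x) (ltn_ord y) isT.
  by move: mxy; rewrite /mixed !inE -!P.
split=> // v; move: c0; rewrite subnn leqn0 cards_eq0 => /eqP/setP/(_ v).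
by rewrite !inE => ->.
Qed.

Lemma write_output_correct s k :
    row_offsets s -> reg s 1 = n -> reg s 2 = k -> k <= n ->
  output (run n write_output s)
  = encode_partition (fun i : 'I_k => part (placed s) i).
Proof.
move=> off r1 r2 kn.
rewrite /write_output run_seq run_set_reg.
set s' := run n _ s.
have r2' : reg s' 2 = k by rewrite /s' run_reg.
have off' : row_offsets s' by move=> i; rewrite /s' run_arr //; exact: off.
have cells i v : i < k -> v < n -> arr s' 0 (i * n + v) = (arr s 3 v == i.+1).
  suff h : forall i v, i < n -> i < k -> v < n -> arr s' 0 (i * n + v) = (arr s 3 v == i.+1).
    by move=> ik; apply: h => //; exact: leq_trans ik kn.
  move=> {i v}; apply: (run_for (I := fun j s' => forall i v, i < j -> i < k -> v < n ->
    arr s' 0 (i * n + v) = (arr s 3 v == i.+1))) => //.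
  move=> j s1 jn r3 [fr fa] IH i v.
  have r21 : reg s1 2 = k by rewrite fr.
  rewrite runE eval_lt /= r3 r21; have [jk|kj] := ltnP j k; last first.
    by rewrite runE /= => ij ik vn; apply: IH => //; lia.
  rewrite ltnS leq_eqVlt => ij ik vn.
  suff h : forall v, v < n -> (i < j) || (i == j) && (v < n) ->
      arr (run n (PFor 4 (PArr 0 (Add (Get 1 (Reg 3)) (Reg 4))
         (EEq (Get 3 (Reg 4)) (Add (Reg 3) (Const 1))))) s1) 0 (i * n + v)
      = (arr s 3 v == i.+1).
    by apply: h; rewrite // vn andbT orbC.
  move=> {v vn ij}.
  apply: (run_for (I := fun l s' => forall v, v < n -> (i < j) || (i == j) && (v < l) ->
      arr s' 0 (i * n + v) = (arr s 3 v == i.+1))) => //.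
    by move=> v vn; rewrite ltn0 andbF orbF => ij; apply: IH.
  move=> l s2 ln r4 [fr2 fa2] IH2 v vn seen.
  have r32 : reg s2 3 = j by rewrite fr2.
  have a1 : arr s2 1 j = j * n by rewrite fa2 // fa // off // ltnW.
  have a3 : arr s2 3 l = arr s 3 l by rewrite fa2 // fa.
  rewrite runE eval_eq /= r32 r4 a1 a3 row_eq // addn1.
  case: ifP => [/andP[/eqP-> /eqP->]//|ne].
  apply: IH2 => //; case/orP: seen => [->//|/andP[ij]].
  by move: ne; rewrite ltnS leq_eqVlt ij /= => -> /= ->; rewrite orbT.
rewrite /output /= r2' off' //.
have szE : size (encode_partition (fun i : 'I_k => part (placed s) i)) = k * n.
  by rewrite size_allpairs !size_enum_ord.
apply: (@eq_from_nth _ 0); first by rewrite size_mkseq szE.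
move=> m; rewrite size_mkseq => mkn; rewrite nth_mkseq //.
have n0 : 0 < n by case: n mkn; rewrite ?muln0.
have ik : m %/ n < k by rewrite ltn_divLR.
have vn : m %% n < n by rewrite ltn_mod.
rewrite [in LHS](divn_eq m n) cells // [in RHS](divn_eq m n).
rewrite -[n in _ * n + _](size_enum_ord n).
rewrite (nth_allpairs _ (Ordinal ik) (Ordinal vn)) ?size_enum_ord //.
by rewrite (nth_ord_enum _ (Ordinal ik)) (nth_ord_enum _ (Ordinal vn)) inE.
Qed.

End Run.

(** * The input encoding and the complete algorithm *)

Lemma size_encode_instance (x : gl_instance) :
  size (encode_instance x) = 2 + gl_n x * gl_n x + gl_k x + gl_k x.
Proof.
by rewrite /encode_instance !size_cat size_allpairs 2!size_map !size_enum_ord /=; lia.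
Qed.

Lemma nth_encode_adj (x : gl_instance) (u v : 'I_(gl_n x)) :
  nth 0 (encode_instance x) (2 + (u * gl_n x + v)) = gl_graph x u v.
Proof.
rewrite /encode_instance nth_cat /= add2n subSS subSS subn0 nth_cat.
rewrite size_allpairs !size_enum_ord.
have -> : u * gl_n x + v < gl_n x * gl_n x.
  by have := ltn_ord u; have := ltn_ord v; nia.
rewrite -[X in _ * X + _]size_enum_ord (nth_allpairs _ u v) ?size_enum_ord //.
by rewrite !nth_ord_enum.
Qed.

Lemma nth_encode_terminal (x : gl_instance) (i : 'I_(gl_k x)) :
  nth 0 (encode_instance x) (2 + (gl_n x * gl_n x + i)) = gl_terminal i.
Proof.
rewrite /encode_instance nth_cat /= add2n subSS subSS subn0 nth_cat.
rewrite size_allpairs !size_enum_ord ltnNge leq_addr addKn nth_cat.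
by rewrite size_map size_enum_ord ltn_ord (nth_map i) ?size_enum_ord // nth_ord_enum.
Qed.

Lemma nth_encode_size (x : gl_instance) (i : 'I_(gl_k x)) :
  nth 0 (encode_instance x) (2 + (gl_n x * gl_n x + (gl_k x + i))) = gl_size i.
Proof.
rewrite /encode_instance nth_cat /= add2n subSS subSS subn0 nth_cat.
rewrite size_allpairs !size_enum_ord ltnNge leq_addr addKn nth_cat.
rewrite size_map size_enum_ord ltnNge leq_addr addKn /=.
by rewrite (nth_map i) ?size_enum_ord // nth_ord_enum.
Qed.

Lemma size_le_bit_size w : size w <= bit_size w.
Proof. by rewrite -sum1_size; apply: leq_sum. Qed.

(** Well-formed programs never write register 1, so it holds [n] from the start. *)
Lemma solver_correct (x : gl_instance) :
    k_connected (gl_graph x) (gl_k x) ->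
    (forall A : {set 'I_(gl_n x)}, A != set0 ->
       exists2 v, v \in A & simplicial_in (gl_graph x) A v) ->
  exists V : 'I_(gl_k x) -> {set 'I_(gl_n x)}, is_gl_partition V /\
    output (run (gl_n x) solver (set_reg (input_state (encode_instance x)) 1 (gl_n x)))
    = encode_partition V.
Proof.
move=> kc chordal; set n := gl_n x; set k := gl_k x.
have kn : k <= n by case: kc => /ltnW; rewrite card_ord.
rewrite /solver 5!run_seq [run n (PReg 2 _) _]run_set_reg.
set s0 := set_reg (set_reg _ 1 _) 2 _.
have r2 : reg s0 2 = k by [].
have a0 : arr s0 0 = nth 0 (encode_instance x) by [].
set s1 := run n offsets s0; set s2 := run n order_vertices s1.
set s3 := run n place_terminals s2; set s4 := run n grow_parts s3.
have off1 : row_offsets n s1 by apply: offsets_correct.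
have off2 : row_offsets n s2 by move=> i; rewrite /s2 run_arr //; exact: off1.
have off3 : row_offsets n s3 by move=> i; rewrite /s3 run_arr //; exact: off2.
have off4 : row_offsets n s4 by move=> i; rewrite /s4 run_arr //; exact: off3.
have adj2 : forall u v : 'I_n, adjn n s2 u v = gl_graph x u v.
  move=> u v; rewrite /adjn /s2 run_arr // /s1 run_arr // a0 nth_encode_adj.
  by case: (gl_graph x u v).
have [||pos_inj pos_sm] := @order_vertices_correct n (gl_graph x) s1 off1 _ _ chordal.
- by move=> v; rewrite /s1 run_arr.
- by move=> u v; rewrite -adj2 /adjn /s2 run_arr.
rewrite -/s2 in pos_inj pos_sm.
have el := k_connected_elim_order pos_inj (gl_k_gt0 x) kc pos_sm.
have r12 : reg s2 1 = n by rewrite /s2 run_reg // /s1 run_reg.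
have r22 : reg s2 2 = k by rewrite /s2 run_reg // /s1 run_reg.
have a20 : arr s2 0 = nth 0 (encode_instance x) by rewrite /s2 run_arr // /s1 run_arr.
have [||||h1 h2] := place_terminals_correct (@gl_terminal_inj x) r12 r22 kn off2
  (sz := @gl_size x) _ _ _ _.
- by move=> i; rewrite a20 nth_encode_terminal.
- by move=> i; rewrite a20 nth_encode_size.
- by move=> v; rewrite /s2 run_arr // /s1 run_arr.
- by move=> v; rewrite /s2 run_arr // /s1 run_arr.
rewrite -/s3 in h1 h2.
have a3 a : a \notin [:: 5; 3; 4] -> arr s3 a = arr s2 a by move=> ?; rewrite /s3 run_arr.
have adj3 : adjo s3 = gl_graph x :> rel 'I_n.
  apply: functional_extensionality => u; apply: functional_extensionality => v.
  by rewrite -adj2 /adjo /adjn a3.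
have I3 : state_inv (gl_graph x) (@gl_terminal x) (@gl_size x) (fun v => arr s2 2 v) s3.
  have inv : invariant (gl_graph x) (@gl_terminal x) (@gl_size x) (fun v : 'I_n => arr s2 2 v)
      (alive n s3) (adjo s3) (placed s3).
    rewrite adj3; apply: (inv_init (@gl_terminal_inj x) (@gl_size_gt0 x) el).
    - by move=> i; case: (h1 i).
    - by move=> v; case: (h2 v) => [[? _]|?]; [left | right].
    - move=> v pv; rewrite inE; case: (h2 v) => [[_ ->] //|[i e]].
      by move: pv; rewrite e /placed; have [_ -> _] := h1 i.
    by move=> i; rewrite inE; have [_ _ ->] := h1 i; rewrite eqb0 -ltnNge.
  split=> // [v|i]; first by rewrite a3.
  have [-> _ _] := h1 i; congr (_ - _).
  rewrite -(cards1 (gl_terminal i)); apply: eq_card => v; rewrite !inE.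
  apply/eqP/eqP => [->|pv]; first by rewrite /placed; have [_ -> _] := h1 i.
  case: (h2 v) => [[e _]|[j e]]; first by move: pv; rewrite /placed e.
  by move: pv; rewrite e /placed; have [_ -> _] := h1 j; move=> -[/val_inj ->].
have [I4 placed4] := grow_parts_correct pos_inj (gl_size_sum x) off3 I3.
rewrite -/s4 in I4 placed4.
exists (fun i => part (placed s4) i); split; last first.
  apply: write_output_correct => //.
    by rewrite /s4 run_reg // /s3 run_reg.
  by rewrite /s4 run_reg // /s3 run_reg.
have [I _ _] := I4.
split.
- move=> i j ij; rewrite -setI_eq0; apply/eqP/setP=> v; rewrite !inE.
  by apply: contra_neqF ij => /andP[/eqP-> /eqP[]] /val_inj.
- apply/setP=> v; rewrite inE; apply/bigcupP.
  by have [i e] := succ_ord (inv_bound I v) (placed4 v); exists i; rewrite // inE e.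
move=> i; have [_ ti ci] := inv_part I i; split=> //.
apply: (inv_complete _ I) => //; by rewrite card_ord; exact: gl_size_sum.
Qed.

Theorem corollary9 (R : realType) :
  poly_time_solvable encode_instance
    (fun x : gl_instance =>
       k_connected (gl_graph x) (gl_k x) /\ interval_graph R (gl_graph x))
    (fun (x : gl_instance) (w : seq nat) =>
       exists V : 'I_(gl_k x) -> {set 'I_(gl_n x)},
         is_gl_partition V /\ w = encode_partition V).
Proof.
have [c [d hT]] := time_poly solver.
(* Loading [n] into register 1 takes 3 steps, hence [c + 3]. *)
exists (Seq (SetReg 1 (Get 0 (Const 0))) (compile solver)), (c + 3), d.
move=> x [kc itv]; set n := gl_n x; set w := encode_instance x.
have [V [Vpart Vout]] := solver_correct kc (fun A => interval_graph_simplicial itv).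
have [//|t ex tT] := @exec_compile n solver (set_reg (input_state w) 1 n) wf_solver.
exists (3 + t), (run n solver (set_reg (input_state w) 1 n)); split; last by exists V.
  exact: exec_seq (exec_set_reg (input_state w) 1 (Get 0 (Const 0))) ex.
(* Besides two header words, the input has [n * n] matrix entries of at least one bit each. *)
have nb : n.+1 <= bit_size w.
  apply: leq_trans (size_le_bit_size w); rewrite size_encode_instance -/n.
  by case: (n) => [|m]; nia.
have nd : n.+1 ^ d <= bit_size w ^ d by case: (d) => // e; rewrite leq_exp2r.
have := hT n; move: nd tT; move: (time n solver) (n.+1 ^ d) (bit_size w ^ d); nia.
Qed.
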